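(* Let $p\geq 3$ be a prime, let $d\ge 1$, and let $U=\langle x_r(t): r\in\Phi^+, t\in\mathbb{Z}/p\mathbb{Z}\rangle$ be the unipotent subgroup of the Chevalley group $A_d(\mathbb{Z}/p\mathbb{Z})$ (i.e. the group of $(d+1)\times(d+1)$ upper unitriangular matrices over $\mathbb{Z}/p\mathbb{Z}$). Then every nontrivial factor of the adjoint series of $U$ (the series at which the adjoint refinement process, started from the lower central series of $U$, stabilizes) has order $p$ or $p^2$.
   Context: Notation: $\Phi$ is the root system of type $A_d$ with positive roots $\Phi^+$, and $x_r(t)=\exp(t\,\mathrm{ad}\,e_r)$ for a Chevalley basis. $\mathbb{N}=\{0,1,2,\dots\}$; $[x,y]=x^{-1}y^{-1}xy$; $[A,B]=\langle [a,b]:a\in A,b\in B\rangle$ for subgroups; $[A_1]=A_1$ and $[A_1,\dots,A_{n+1}]=[[A_1,\dots,A_n],A_{n+1}]$. $\gamma_i=\gamma_i(U)$ is the lower central series, $\gamma_1=U$. $\mathbb{N}^k$ is ordered lexicographically by $\preceq$ (strict part $\prec$), and $e_1=(1,0,\dots,0)$. Filters: a filter is a function $\phi$ from $\mathbb{N}^k$ to subgroups of $U$ with $[\phi_m,\phi_n]\le\phi_{m+n}$, and $\phi_m\ge\phi_n$ whenever $m\preceq n$. Put $\partial\phi_m=\langle\phi_{m+s}:s\in\mathbb{N}^k\setminus\{0\}\rangle$ and $L_m=\phi_m/\partial\phi_m$. Commutation induces biadditive maps $\circ:L_s\times L_t\to L_{s+t}$, $(\partial\phi_s x,\partial\phi_t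 y)\mapsto\partial\phi_{s+t}[x,y]$. Generated filter: if $0\in\mathcal{S}\subseteq\mathbb{N}^k$ generates $\mathbb{N}^k$ and $\pi$ maps $\mathcal{S}$ to normal subgroups of $U$, then $\bar\pi_n=\prod[\pi_{s_1},\dots,\pi_{s_r}]$, the product over all finite sequences (paths) $(s_1,\dots,s_r)$ in $\mathcal{S}$, $r\ge1$, with $s_1+\dots+s_r=n$. Adjoint ring: for a biadditive $\circ:L_s\times L_t\to L_{s+t}$, $\mathrm{Adj}(\circ)=\{(f,g)\in\mathrm{End}(L_s)\times\mathrm{End}(L_t)^{\mathrm{op}}: uf\circ v=u\circ gv \ \forall u\in L_s, v\in L_t\}$; it acts on the right of $L_s$ through $f$. Adjoint refinement process: for $k\geq1$ let $\mathcal{S}_k=\{n\in\mathbb{N}^k:n\prec 2e_1\}$. Start with $\mathcal{S}_1=\{0,1\}$, $\pi_1(0)=\pi_1(1)=U$, and $\alpha^{(1)}=\bar\pi_1$, so $\alpha^{(1)}_0=U$ and $\alpha^{(1)}_i=\gamma_i$ for $i\ge1$. Given $\pi_k:\mathcal{S}_k\to\{\text{normal subgroups of }U\}$ and $\alpha^{(k)}=\bar\pi_k$, let $J$ be the Jacobson radical of $\mathrm{Adj}(\circ)$ for the map $\circ:L^{(k)}_{e_1}\times L^{(k)}_{e_1}\to L^{(k)}_{2e_1}$ of the filter $\alpha^{(k)}$ (with $L^{(k)}_{n}=\alpha^{(k)}_n/\partial\alpha^{(k)}_n$). If $J=0$ the process stops and $\alpha=\alpha^{(k)}$ is the adjoint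 series. If $J\neq0$, let $J^0=\mathrm{Adj}(\circ)$, $J^{i+1}=J^iJ$, and let $\partial\alpha^{(k)}_{e_1}\le K_i\le\alpha^{(k)}_{e_1}$ be given by $K_i/\partial\alpha^{(k)}_{e_1}=L^{(k)}_{e_1}J^i$. On $\mathcal{S}_{k+1}=\mathcal{S}_k\times\mathbb{N}$ define $\pi_{k+1}(n,i)=K_i$ if $n=e_1$ and $\pi_{k+1}(n,i)=\pi_k(n)$ otherwise, and set $\alpha^{(k+1)}=\bar\pi_{k+1}$. The subgroups $\alpha_n$ form a chain; the (nontrivial) factors of the adjoint series are the quotients of consecutive distinct members of this chain. *)

(* Defs.v *)
From HB Require Import structures.
From mathcomp Require Import all_boot all_order all_algebra all_fingroup.
From mathcomp Require Import commutator.
From mathcomp Require Import boolp.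

Set Implicit Arguments.
Unset Strict Implicit.
Unset Printing Implicit Defensive.

Import GroupScope GRing.Theory.

(* A finite abelian group A, written additively. *)
Definition add_group (gT : finGroupType) (A : {group gT}) (cA : abelian A) :
  Type := subg_of A.

Section AddGroup.

Variables (gT : finGroupType) (A : {group gT}) (cA : abelian A).

HB.instance Definition _ := Finite.on (add_group cA).

Let addg (x y : add_group cA) : add_group cA := (x : subg_of A) * y.
Let oppg (x : add_group cA) : add_group cA := (x : subg_of A)^-1.
Let zerog : add_group cA := (1 : subg_of A).

Fact add_groupA : associative addg. Proof. exact: mulgA. Qed.
Fact add_groupC : commutative addg.
Proof.
move=> x y; apply: val_inj => /=.
exact: (centsP cA _ (subgP _) _ (subgP _)).
Qed.
Fact add_group0 : left_id zerog addg. Proof. exact: mul1g. Qed.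
Fact add_groupN : left_inverse zerog oppg addg. Proof. exact: mulVg. Qed.

HB.instance Definition _ :=
  GRing.isZmodule.Build (add_group cA)
    add_groupA add_groupC add_group0 add_groupN.

Definition of_add_group (x : add_group cA) : gT := sgval x.
Definition to_add_group (x : gT) : add_group cA := subg A x.

Lemma of_add_groupP x : of_add_group x \in A.
Proof. exact: subgP. Qed.

Lemma of_add_group_inj : injective of_add_group.
Proof. exact: val_inj. Qed.

Lemma to_add_groupK x : x \in A -> of_add_group (to_add_group x) = x.
Proof. exact: subgK. Qed.

Lemma of_add_groupD x y :
  of_add_group (x + y)%R = of_add_group x * of_add_group y.
Proof. by []. Qed.

Lemma of_add_group0 : of_add_group 0%R = 1.
Proof. by []. Qed.

End AddGroup.

Section Rings.

Local Open Scope ring_scope.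

(* Endomorphisms of V as operators on the right: v (f * g) = (v f) g. *)
Section Endo.

Variable V : finZmodType.

Definition additiveb (f : {ffun V -> V}) :=
  [forall x, forall y, f (x + y) == f x + f y].

Record endo := Endo { endo_fun :> {ffun V -> V}; _ : additiveb endo_fun }.

HB.instance Definition _ := [isSub for endo_fun].
HB.instance Definition _ := [Finite of endo by <:].

Lemma endoD (f : endo) : {morph f : x y / x + y}.
Proof. by move=> x y; case: f => f /= /forallP/(_ x)/forallP/(_ y)/eqP. Qed.

Lemma additivebP (f : {ffun V -> V}) :
  reflect {morph f : x y / x + y} (additiveb f).
Proof.
apply: (iffP forallP) => [fD x y | fD x]; first by have /forallP/(_ y)/eqP := fD x.
by apply/forallP => y; rewrite fD.
Qed.

Fact additiveb_closed : zmod_closed additiveb.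
Proof.
split=> [|f g /additivebP fD /additivebP gD].
  by apply/additivebP => x y; rewrite !ffunE addr0.
by apply/additivebP => x y; rewrite !ffunE fD gD opprD addrACA.
Qed.

HB.instance Definition _ := GRing.isZmodClosed.Build _ additiveb additiveb_closed.
HB.instance Definition _ := [SubChoice_isSubZmodule of endo by <:].

Fact endo1_subproof : additiveb [ffun x => x].
Proof. by apply/additivebP => x y; rewrite !ffunE. Qed.
Definition endo1 := Endo endo1_subproof.

Fact endo_mul_subproof (f g : endo) : additiveb [ffun x => g (f x)].
Proof. by apply/additivebP => x y; rewrite !ffunE !endoD. Qed.
Definition endo_mul f g := Endo (endo_mul_subproof f g).

Fact endo_mulA : associative endo_mul.
Proof. by move=> f g h; apply/val_inj/ffunP => x; rewrite !ffunE. Qed.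
Fact endo_mul1l : left_id endo1 endo_mul.
Proof. by move=> f; apply/val_inj/ffunP => x; rewrite !ffunE. Qed.
Fact endo_mul1r : right_id endo1 endo_mul.
Proof. by move=> f; apply/val_inj/ffunP => x; rewrite !ffunE. Qed.
Fact endo_mulDl : left_distributive endo_mul +%R.
Proof. by move=> f g h; apply/val_inj/ffunP => x; rewrite /= !ffunE endoD. Qed.
Fact endo_mulDr : right_distributive endo_mul +%R.
Proof. by move=> f g h; apply/val_inj/ffunP => x; rewrite /= !ffunE. Qed.

HB.instance Definition _ := GRing.Zmodule_isPzRing.Build endo
  endo_mulA endo_mul1l endo_mul1r endo_mulDl endo_mulDr.

End Endo.

Record biadditive (V V' W : zmodType) := Biadditive {
  biadditive_fun :> V -> V' -> W;
  biadditiveDl : forall v, {morph biadditive_fun^~ v : x y / x + y};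
  biadditiveDr : forall u, {morph biadditive_fun u : x y / x + y} }.

(* As (f * f') u = f' (f u) in [endo V], multiplication in the converse ring  *)
(* [(endo V')^c] is the composition (g * g') v = g (g' v) of operators on the *)
(* left.                                                                      *)
Section Adjoint.

Variables (V V' : finZmodType) (W : zmodType) (b : biadditive V V' W).

Definition adjoint_pair (fg : (endo V * (endo V')^c)%type) :=
  [forall u, forall v, b (fg.1 u) v == b u ((fg.2 : endo V') v)].

Definition adjoint_ring : Type := {fg | adjoint_pair fg}.

HB.instance Definition _ := SubType.on adjoint_ring.
HB.instance Definition _ := Finite.on adjoint_ring.

Lemma adjoint_pairP (fg : (endo V * (endo V')^c)%type) :
  reflect (forall u v, b (fg.1 u) v = b u ((fg.2 : endo V') v))
          (adjoint_pair fg).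
Proof.
apply: (iffP forallP) => [fgP u v | fgP u].
  by have /forallP/(_ v)/eqP := fgP u.
by apply/forallP => v; apply/eqP.
Qed.

Fact adjoint_pair_subring : subring_closed adjoint_pair.
Proof.
have bl := biadditiveDl b; have br := biadditiveDr b.
have b0l v : b 0 v = 0 by apply: (addIr (b 0 v)); rewrite -bl !add0r.
have b0r u : b u 0 = 0 by apply: (addIr (b u 0)); rewrite -br !add0r.
have bNl u v : b (- u) v = - b u v.
  by apply: (addIr (b u v)); rewrite -bl !addNr b0l.
have bNr u v : b u (- v) = - b u v.
  by apply: (addIr (b u v)); rewrite -br !addNr b0r.
split=> [|x y /adjoint_pairP xP /adjoint_pairP yP
         |x y /adjoint_pairP xP /adjoint_pairP yP]; apply/adjoint_pairP => u v.
- by rewrite !ffunE.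
- by rewrite !ffunE bl br bNl bNr xP yP.
- by rewrite !ffunE yP xP.
Qed.

HB.instance Definition _ :=
  GRing.SubChoice_isSubPzRing.Build _ adjoint_pair adjoint_ring
    adjoint_pair_subring.

Definition adjoint_act (u : V) (a : adjoint_ring) : V := (val a).1 u.

End Adjoint.

Section Radical.

Variable R : pzRingType.

Definition left_ideal (S : {pred R}) :=
  0 \in S /\ forall a, {in S &, forall u v, a * u + v \in S}.

Definition maximal_left_ideal (S : {pred R}) :=
  [/\ left_ideal S, 1 \notin S &
      forall T : {pred R}, left_ideal T -> 1 \notin T ->
        {subset S <= T} -> {subset T <= S}].

Definition jacobson_radical (x : R) :=
  forall S : {pred R}, maximal_left_ideal S -> x \in S.

Definition ideal_mul (I J : R -> Prop) (x : R) :=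
  exists n (a b : 'I_n -> R),
    (forall i, I (a i) /\ J (b i)) /\ x = \sum_i a i * b i.

Fixpoint ideal_exp (J : R -> Prop) (i : nat) : R -> Prop :=
  if i is i'.+1 then ideal_mul (ideal_exp J i') J else fun _ => True.

End Radical.

End Rings.

Section Indices.

Variable k : nat.

Definition lex_lt (m n : nat ^ k) :=
  ([tuple m i | i < k] < [tuple n i | i < k] :> k.-tuplelexi nat)%O.

End Indices.

Definition e1 {k} : nat ^ k.+1 := [ffun i => (i == ord0 : nat)].

Definition in_S {k} (n : nat ^ k.+1) := lex_lt n (e1 *+ 2)%R.

(* For (n, i) in N^k x N = N^(k+1), this is n. *)
Definition index_front {k} (m : nat ^ k.+1) : nat ^ k :=
  [ffun i => m (widen_ord (leqnSn k) i)].

Definition index_last {k} (m : nat ^ k.+1) : nat := m ord_max.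

Lemma e1_neq0 k : (e1 != 0 :> nat ^ k.+1)%R.
Proof. by apply/eqP => /ffunP/(_ ord0); rewrite !ffunE eqxx. Qed.

Lemma index_addr_neq0 k (s t : nat ^ k) : (s != 0 -> s + t != 0)%R.
Proof.
apply: contra => /eqP /ffunP st0; apply/eqP/ffunP => i.
by have /eqP := st0 i; rewrite !ffunE addn_eq0 => /andP[/eqP].
Qed.

Lemma in_SI k (n : nat ^ k.+1) : (n ord0 < 2)%N -> in_S n.
Proof.
move=> n0; apply/Order.TupleLexiOrder.ltxi_tuplePlt; exists ord0 => //.
by rewrite !tnth_mktuple !ffunE.
Qed.

Section Filter.

Variables (gT : finGroupType) (U : {group gT}).

(* The last two properties hold along the adjoint refinement process, and are *)
(* used below to see that the subgroups K_i are normal in U. The values of pi *)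
(* off in_S are irrelevant.                                                   *)
Record prefilter k := Prefilter {
  prefilter_fun :> nat ^ k.+1 -> {group gT};
  prefilter_normal : forall n, prefilter_fun n <| U;
  prefilter0 : prefilter_fun 0%R = U;
  prefilter_top : exists2 s, (s != 0)%R && in_S s & prefilter_fun s = U }.

Section Series.

Variables (k : nat) (pi : prefilter k).
Local Notation index := (nat ^ k.+1)%type.

(* [pi_s, pi_(t_1), ..., pi_(t_r)] *)
Definition path_commutator (s : index) (p : seq index) : {set gT} :=
  foldl (fun A t => [~: A, pi t]) (pi s) p.

(* The subgroups [pi_s, pi_(t_1), ...] are normal in U, so that their product *)
(* is the subgroup they generate. Paths have r >= 1 terms: they are of the    *)
(* form s :: p.                                                               *)
Definition generated_filter (n : index) : {group gT} :=
  <<[set x | `[< exists s p, [/\ all in_S (s :: p),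
                  (\sum_(t <- s :: p) t)%R = n & x \in path_commutator s p] >]]>>%G.

Local Notation alpha := generated_filter.

Definition boundary (n : index) : {group gT} :=
  <<[set x | `[< exists2 s, (s != 0)%R & x \in alpha (n + s)%R >]]>>%G.

Definition factor (n : index) : {group coset_of (boundary n)} :=
  (alpha n / boundary n)%G.

Lemma path_commutator_group s p : group_set (path_commutator s p).
Proof.
elim/last_ind: p => [|p t _]; first exact: groupP.
by rewrite /path_commutator foldl_rcons; apply: groupP.
Qed.

Lemma path_commutator_normal s p : path_commutator s p <| U.
Proof.
elim/last_ind: p => [|p t IHp]; first exact: prefilter_normal.
rewrite /path_commutator foldl_rcons.
have := IHp; have := path_commutator_group s p.
rewrite /path_commutator; set A := foldl _ _ _ => gA nA.
have /andP[sP nP] := prefilter_normal pi t; have /andP[sA nUA] := nA.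
rewrite /normal normsR // andbT.
exact: subset_trans (commgSS sA sP) (der_sub 1 U).
Qed.

Lemma gen_exists_normal (I : Type) (P : I -> Prop) (A : I -> {set gT}) :
    (forall i, P i -> A i <| U) ->
  <<[set x | `[< exists2 i, P i & x \in A i >]]>> <| U.
Proof.
move=> nA; apply/andP; split.
  rewrite gen_subG; apply/subsetP => x; rewrite inE => /asboolP[i Pi].
  by apply/subsetP; have /andP[] := nA i Pi.
apply: norms_gen; apply/subsetP => u Uu; rewrite inE.
apply/subsetP => _ /imsetP[x + ->]; rewrite inE => /asboolP[i Pi Aix].
rewrite inE; apply/asboolP; exists i => //; rewrite memJ_norm //.
by have /andP[_ /subsetP] := nA i Pi; apply.
Qed.

Lemma generated_filter_normal n : alpha n <| U.
Proof.
rewrite /= (_ : [set x | _] = [set x | `[< exists2 sp : index * seq index,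
    all in_S (sp.1 :: sp.2) /\ (\sum_(t <- sp.1 :: sp.2) t)%R = n &
    x \in path_commutator sp.1 sp.2 >]]).
  by apply: gen_exists_normal => -[s p] _; apply: path_commutator_normal.
apply/setP => x; rewrite !inE; apply/asboolP/asboolP.
  by move=> [s [p [Ssp sum_sp xsp]]]; exists (s, p).
by move=> [[s p] [Ssp sum_sp] xsp]; exists s, p.
Qed.

Lemma boundary_normal n : boundary n <| U.
Proof. by apply: gen_exists_normal => s _; apply: generated_filter_normal. Qed.

Lemma sub_boundary n s : (s != 0)%R -> alpha (n + s)%R \subset boundary n.
Proof.
move=> s0; apply/subsetP => x xs; apply: mem_gen; rewrite inE.
by apply/asboolP; exists s.
Qed.

Lemma path_sub_generated s p n :
    all in_S (s :: p) -> (\sum_(t <- s :: p) t)%R = n ->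
  path_commutator s p \subset alpha n.
Proof.
move=> Ssp sum_sp; apply/subsetP => x xsp; apply: mem_gen; rewrite inE.
by apply/asboolP; exists s, p.
Qed.

Lemma comm_gen_sub (X : {set gT}) (B D : {group gT}) :
    B \subset U -> D <| U -> X \subset U ->
    (forall x, x \in X -> [~: [set x], B] \subset D) ->
  [~: <<X>>, B] \subset D.
Proof.
move=> BU /andP[_ nDU] XU XB.
have nDB := subset_trans BU nDU; have nDX := subset_trans XU nDU.
rewrite -quotient_cents2 ?gen_subG // quotient_gen // gen_subG.
apply/subsetP => _ /morphimP[x nDx Xx ->].
have := XB x Xx; rewrite -quotient_cents2 ?sub1set // => /subsetP; apply.
by apply: mem_morphim => //; apply: set11.
Qed.

Lemma comm_alpha_sub n (B D : {group gT}) :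
    B \subset U -> D <| U ->
    (forall s p, all in_S (s :: p) -> (\sum_(t <- s :: p) t)%R = n ->
       [~: path_commutator s p, B] \subset D) ->
  [~: alpha n, B] \subset D.
Proof.
move=> BU nDU pB; apply: comm_gen_sub => //.
  apply/subsetP => x; rewrite inE => /asboolP[s [p [_ _]]].
  by apply/subsetP; have /andP[] := path_commutator_normal s p.
move=> x; rewrite inE => /asboolP[s [p [Ssp sum_sp xsp]]].
by apply: subset_trans (pB s p Ssp sum_sp); apply: commSg; rewrite sub1set.
Qed.

Lemma comm_boundary_sub n (B D : {group gT}) :
    B \subset U -> D <| U ->
    (forall s, (s != 0)%R -> [~: alpha (n + s)%R, B] \subset D) ->
  [~: boundary n, B] \subset D.
Proof.
move=> BU nDU sB; apply: comm_gen_sub => //.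
  apply/subsetP => x; rewrite inE => /asboolP[s _].
  by apply/subsetP; have /andP[] := generated_filter_normal (n + s)%R.
move=> x; rewrite inE => /asboolP[s s0 xs].
by apply: subset_trans (sB s s0); apply: commSg; rewrite sub1set.
Qed.

Lemma generated_filter_comm m n :
  [~: alpha m, alpha n] \subset alpha (m + n)%R.
Proof.
have sU l : alpha l \subset U := normal_sub (generated_filter_normal l).
rewrite commGC; apply: comm_alpha_sub; rewrite ?generated_filter_normal //.
move=> s p; elim/last_ind: p n m => [|p t IHp] n m.
  rewrite /= andbT big_seq1 => Ss <-; rewrite commGC.
  apply: comm_alpha_sub; rewrite ?generated_filter_normal //.
    exact: normal_sub (prefilter_normal pi s).
  move=> s' p' Sp' sum_p'.
  suff -> : [~: path_commutator s' p', path_commutator s [::]]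
            = path_commutator s' (rcons p' s).
    apply: path_sub_generated.
      by rewrite -rcons_cons all_rcons Ss.
    by rewrite -rcons_cons -cats1 big_cat /= big_seq1 sum_p'.
  by rewrite /path_commutator foldl_rcons.
rewrite -rcons_cons all_rcons -cats1 big_cat /= big_seq1.
case/andP=> St Ssp sum_spt.
have gP := path_commutator_group s p.
have nP := path_commutator_normal s p.
rewrite /path_commutator foldl_rcons -[foldl _ _ _]/(path_commutator s p).
pose P := Group gP; rewrite -[path_commutator s p]/(gval P) in nP *.
set A := alpha m; set D := alpha (m + n)%R.
have [_ nDU] := andP (generated_filter_normal (m + n)%R).
have PU := normal_sub nP; have TU := normal_sub (prefilter_normal pi t).
have AU : A \subset U := sU m.
pose q := (\sum_(j <- s :: p) j)%R.
have q_n : (q + t)%R = n by rewrite -sum_spt /q big_cons.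
have PA l : [~: P, alpha l] \subset alpha (l + q)%R.
  by apply: IHp; rewrite ?Ssp.
have aT l : [~: alpha l, pi t] \subset alpha (l + t)%R.
  apply: comm_alpha_sub; rewrite ?generated_filter_normal // => s' p' Sp' sum_p'.
  suff -> : [~: path_commutator s' p', pi t] = path_commutator s' (rcons p' t).
    apply: path_sub_generated.
      by rewrite -rcons_cons all_rcons St.
    by rewrite -rcons_cons -cats1 big_cat /= big_seq1 sum_p'.
  by rewrite /path_commutator foldl_rcons.
have nD (X : {group gT}) : X \subset U -> X \subset 'N(D).
  by move/subset_trans; apply.
have dU : [~: U, U] \subset U by apply: (der_sub 1 U).
have trivD (X Y Z : {group gT}) : X \subset U -> Y \subset U -> Z \subset U ->
    [~: X, Y, Z] \subset D -> [~: X / D, Y / D, Z / D] = 1.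
  move=> XU YU ZU sXYZ; rewrite -!quotientR ?nD //.
    by apply/trivgP; rewrite quotient_sub1 ?(subset_trans sXYZ) ?normG.
  exact: subset_trans (commgSS XU YU) dU.
have c1 : [~: pi t, A, P] \subset D.
  apply: subset_trans (_ : [~: alpha (m + t)%R, P] \subset _).
    by apply: commSg; rewrite commGC; apply: aT.
  by rewrite commGC /D -q_n addrA addrAC; apply: PA.
have c2 : [~: A, P, pi t] \subset D.
  apply: subset_trans (_ : [~: alpha (m + q)%R, pi t] \subset _).
    by apply: commSg; rewrite commGC; apply: PA.
  by rewrite /D -q_n addrA; apply: aT.
have PTU := subset_trans (commgSS PU TU) dU.
have := three_subgroup (trivD _ _ _ TU AU PU c1) (trivD _ _ _ AU PU TU c2).
rewrite -!quotientR ?nD // => /eqP; rewrite -subG1 quotient_sub1 //.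
exact: nD (subset_trans (commgSS PTU AU) dU).
Qed.

Lemma factor_abelian n : (n != 0)%R -> abelian (factor n).
Proof.
move=> n0; apply: quotient_cents2r.
exact: subset_trans (generated_filter_comm n n) (sub_boundary n n0).
Qed.

Lemma boundary_comm m n :
  [~: boundary m, alpha n] \subset boundary (m + n)%R.
Proof.
apply: comm_boundary_sub; rewrite ?boundary_normal //.
  exact: normal_sub (generated_filter_normal n).
move=> s s0; apply: subset_trans (generated_filter_comm _ _) _.
by rewrite addrAC; apply: sub_boundary.
Qed.

Definition factor_add (n : index) (n0 : (n != 0)%R) : finZmodType :=
  add_group (factor_abelian n0).

Section Commutation.

Variables (s t : index) (s0 : (s != 0)%R) (t0 : (t != 0)%R).
Let st0 : (s + t != 0)%R := index_addr_neq0 t s0.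

(* The choice of representatives is immaterial, see [commutationE] below.     *)
Definition commutation (u : factor_add s0) (v : factor_add t0) :
    factor_add st0 :=
  to_add_group (factor_abelian st0)
    (coset (boundary (s + t)%R)
       [~ repr (alpha s :&: of_add_group u), repr (alpha t :&: of_add_group v)]).

Let c x y := coset (boundary (s + t)%R) [~ x, y].

Let nB n x : x \in U -> x \in 'N(boundary n).
Proof. by apply/subsetP; have /andP[] := boundary_normal n. Qed.

Let aU n x : x \in alpha n -> x \in U.
Proof. by apply/subsetP; have /andP[] := generated_filter_normal n. Qed.

Let cosetM n x y : x \in U -> y \in U ->
  coset (boundary n) (x * y) = coset (boundary n) x * coset (boundary n) y.
Proof. by move=> xU yU; rewrite morphM ?nB. Qed.

Let comm_in m n x y :
  x \in alpha m -> y \in alpha n -> [~ x, y] \in alpha (m + n)%R.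
Proof.
by move=> xm yn; apply: (subsetP (generated_filter_comm m n)); apply: mem_commg.
Qed.

Let cJ n x y : x \in alpha s -> y \in alpha t -> n != 0%R ->
  forall z, z \in alpha n -> coset (boundary (s + t)%R) ([~ x, y] ^ z) = c x y.
Proof.
move=> xs yt n0 z zn; have xy := comm_in xs yt; have xyz := comm_in xy zn.
have xyz1 : [~ x, y, z] \in boundary (s + t)%R.
  by apply: (subsetP (sub_boundary _ n0)).
rewrite conjg_mulR cosetM ?(aU xy) ?(aU xyz) //.
by rewrite (coset_id xyz1) mulg1.
Qed.

Let cMl x x' y : x \in alpha s -> x' \in alpha s -> y \in alpha t ->
  c (x * x') y = c x y * c x' y.
Proof.
move=> xs xs' yt; have xy := comm_in xs yt; have xy' := comm_in xs' yt.
rewrite /c commMgJ cosetM ?groupJ ?(aU xy) ?(aU xs') ?(aU xy') //.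
by rewrite (cJ xs yt s0 xs').
Qed.

Let cMr x y y' : x \in alpha s -> y \in alpha t -> y' \in alpha t ->
  c x (y * y') = c x y * c x y'.
Proof.
move=> xs yt yt'; have xy := comm_in xs yt; have xy' := comm_in xs yt'.
rewrite /c commgMJ cosetM ?groupJ ?(aU xy) ?(aU yt') ?(aU xy') //.
rewrite (cJ xs yt t0 yt').
apply: (centsP (factor_abelian st0));
  by apply: mem_morphim => //; apply: nB; apply: aU; eassumption.
Qed.

Let c1l x y : x \in boundary s -> y \in alpha t -> c x y = 1.
Proof.
move=> xs yt; apply: coset_id; apply: (subsetP (boundary_comm s t)).
exact: mem_commg.
Qed.

Let c1r x y : x \in alpha s -> y \in boundary t -> c x y = 1.
Proof.
move=> xs yt; apply: coset_id; rewrite -groupV invg_comm addrC.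
by apply: (subsetP (boundary_comm t s)); apply: mem_commg.
Qed.

Let repr_factor n (n0 : (n != 0)%R) (u : factor_add n0) :
  exists2 x, x \in alpha n & of_add_group u = coset (boundary n) x.
Proof.
by have /morphimP[x _ xn ->] := of_add_groupP u; exists x.
Qed.

Let reprP n x (u : coset_of (boundary n)) :
    x \in alpha n -> u = coset (boundary n) x ->
  let y := repr (alpha n :&: u) in
  y \in alpha n /\ exists2 h, h \in boundary n & y = x * h.
Proof.
move=> xn ->; set y := repr _.
have : y \in alpha n :&: coset (boundary n) x.
  apply: (mem_repr x); rewrite inE xn /= val_coset ?rcoset_refl //.
  exact: nB (aU xn).
rewrite inE => /andP[yn]; rewrite val_coset ?nB ?(aU xn) // => yx; split=> //.
exists (x^-1 * y); last by rewrite mulKVg.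
by have := yx; rewrite norm_rlcoset ?nB ?(aU xn) // mem_lcoset.
Qed.

Lemma commutationE x y (u : factor_add s0) (v : factor_add t0) :
    x \in alpha s -> y \in alpha t ->
    of_add_group u = coset (boundary s) x ->
    of_add_group v = coset (boundary t) y ->
  of_add_group (commutation u v) = coset (boundary (s + t)%R) [~ x, y].
Proof.
move=> xs yt ux vy.
have [x's [h hs Dx']] := reprP xs ux; have [y't [l lt Dy']] := reprP yt vy.
rewrite /commutation to_add_groupK; last first.
  have xy := comm_in x's y't.
  by apply: mem_morphim => //; apply: nB (aU xy).
have hs' : h \in alpha s by rewrite -(mulKg x h) groupM ?groupV -?Dx'.
have lt' : l \in alpha t by rewrite -(mulKg y l) groupM ?groupV -?Dy'.
rewrite Dx' Dy' -/(c _ _) cMl ?groupM // cMr // (cMr hs') //.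
by rewrite (c1r xs lt) (c1l hs yt) (c1l hs lt') !mulg1.
Qed.

Fact commutationDl v : {morph commutation^~ v : x y / (x + y)%R}.
Proof.
move=> u u'; have [x xs ux] := repr_factor u.
have [x' xs' ux'] := repr_factor u'; have [y yt vy] := repr_factor v.
apply: of_add_group_inj; rewrite of_add_groupD.
rewrite (commutationE xs yt ux vy) (commutationE xs' yt ux' vy).
rewrite (@commutationE (x * x') y) ?groupM //; first exact: cMl.
by rewrite of_add_groupD ux ux' cosetM ?(aU xs) ?(aU xs').
Qed.

Fact commutationDr u : {morph commutation u : x y / (x + y)%R}.
Proof.
move=> v v'; have [x xs ux] := repr_factor u.
have [y yt vy] := repr_factor v; have [y' yt' vy'] := repr_factor v'.
apply: of_add_group_inj; rewrite of_add_groupD.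
rewrite (commutationE xs yt ux vy) (commutationE xs yt' ux vy').
rewrite (@commutationE x (y * y')) ?groupM //; first exact: cMr.
by rewrite of_add_groupD vy vy' cosetM ?(aU yt) ?(aU yt').
Qed.

Definition circ : biadditive (factor_add s0) (factor_add t0) (factor_add st0) :=
  Biadditive commutationDl commutationDr.

End Commutation.

Definition adj : pzRingType := adjoint_ring (circ (e1_neq0 k) (e1_neq0 k)).

Definition radical_trivial := forall a : adj, jacobson_radical a -> a = 0%R.

(* L_(e1) J^i, a group of cosets; [radical_subgroup] is its preimage K_i.     *)
Definition radical_image (i : nat) : {group coset_of (boundary e1)} :=
  <<[set w | `[< exists (u : factor_add (e1_neq0 k)) (a : adj),
       ideal_exp (@jacobson_radical adj) i a /\
       w = of_add_group (adjoint_act u a) >]]>>%G.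

Definition radical_subgroup (i : nat) : {group gT} :=
  (coset (boundary e1) @*^-1 radical_image i)%G.

Lemma radical_subgroup_normal i : radical_subgroup i <| U.
Proof.
have [s /andP[s0 Ss] pis] := prefilter_top pi.
have /andP[sDU nDU] := boundary_normal e1.
have /andP[saU _] := generated_filter_normal e1.
have LF : radical_image i \subset factor e1.
  rewrite gen_subG; apply/subsetP => w; rewrite inE.
  by case/asboolP => u [a [_ ->]]; apply: of_add_groupP.
have cUL : factor e1 \subset 'C(U / boundary e1).
  apply: quotient_cents2r; apply: subset_trans (sub_boundary e1 s0).
  apply: subset_trans (generated_filter_comm e1 s); apply: commgS.
  have /= := @path_sub_generated s [::] s; rewrite Ss big_seq1.
  by rewrite /path_commutator /= pis; apply.
apply/andP; split.
  apply: subset_trans (morphpreS _ LF) _.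
  by rewrite quotientK ?mul_subG // (subset_trans saU).
apply/subsetP => u Uu; rewrite inE; apply/subsetP => _ /imsetP[x Kx ->].
have nDu := subsetP nDU u Uu; have [nDx Lx] := morphpreP Kx.
apply/morphpreP; split; first by rewrite groupJ.
rewrite morphJ // conjgE.
have /commgP : commute (coset (boundary e1) x) (coset (boundary e1) u).
  by apply: (centsP cUL); [apply: (subsetP LF) | apply: mem_morphim].
by move/conjg_fixP; rewrite conjgE => ->.
Qed.

End Series.

Fact initial_top : exists2 s : nat ^ 1, (s != 0)%R && in_S s & U = U.
Proof. by exists e1; rewrite // e1_neq0 in_SI ?ffunE. Qed.

Definition initial_prefilter : prefilter 0 :=
  @Prefilter 0 (fun _ => U) (fun _ => normal_refl U) erefl initial_top.

Section Refinement.

Variables (k : nat) (pi : prefilter k).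

Definition refine (m : nat ^ k.+2) : {group gT} :=
  if index_front m == e1 then radical_subgroup pi (index_last m)
  else pi (index_front m).

Fact refine_normal m : refine m <| U.
Proof.
rewrite /refine; case: ifP => _; first exact: radical_subgroup_normal.
exact: prefilter_normal.
Qed.

Fact refine0 m : index_front m = 0%R -> refine m = U.
Proof.
by move=> m0; rewrite /refine m0 eq_sym (negPf (e1_neq0 k)) prefilter0.
Qed.

Fact index_front0 : index_front (0%R : nat ^ k.+2) = 0%R.
Proof. by apply/ffunP => i; rewrite !ffunE. Qed.

Fact refine_top : exists2 s, (s != 0)%R && in_S s & refine s = U.
Proof.
pose s : nat ^ k.+2 := [ffun i => (i == ord_max : nat)].
exists s; last first.
  apply: refine0; apply/ffunP => i; rewrite !ffunE.
  by rewrite -val_eqE /= ltn_eqF.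
rewrite in_SI ?ffunE // andbT; apply/eqP => /ffunP/(_ ord_max).
by rewrite !ffunE eqxx.
Qed.

Definition refined_prefilter : prefilter k.+1 :=
  Prefilter refine_normal (refine0 index_front0) refine_top.

End Refinement.

(* Stages are counted from 0: stage k is pi_(k+1), which lives on N^(k+1).    *)
Fixpoint stage (k : nat) : prefilter k :=
  if k is k'.+1 then refined_prefilter (stage k') else initial_prefilter.

Definition stage_filter k : nat ^ k.+1 -> {group gT} :=
  generated_filter (stage k).

Definition adjoint_process_stops_at k :=
  radical_trivial (stage k) /\
  forall j, (j < k)%N -> ~ radical_trivial (stage j).

End Filter.

Arguments stage_filter {gT} U%_G k n.

(* A and B are consecutive distinct members of the series phi, B < A. *)
Definition consecutive (gT : finGroupType) (I : Type) (phi : I -> {group gT})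
    (A B : {group gT}) :=
  [/\ exists m, phi m = A, exists n, phi n = B, B \proper A &
      forall l, ~ (B \proper phi l /\ phi l \proper A)].

(* For the root r = eps_i - eps_j (i < j) of A_d, exp(t ad e_r) is the        *)
(* conjugation by 1 + t E_ij, and the elements x_r(t) generate a copy of the  *)
(* group of upper unitriangular matrices.                                     *)
Section Unitriangular.

Variables p d : nat.

Definition unitriangular (M : 'M['F_p]_d.+1) :=
  [forall i : 'I_d.+1, forall j : 'I_d.+1, (j <= i)%N ==> (M i j == (i == j)%:R)%R].

Definition unitriangular_set : {set {'GL_d.+1[ 'F_p ]}} :=
  [set g | unitriangular (@GLval d.+1 _ g)].

Lemma unitriangularP (M : 'M['F_p]_d.+1) :
  reflect (forall i j : 'I_d.+1, (j <= i)%N -> M i j = (i == j)%:R%R)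
          (unitriangular M).
Proof.
apply: (iffP forallP) => [MP i j ji | MP i].
  by have /forallP/(_ j)/implyP/(_ ji)/eqP := MP i.
by apply/forallP => j; apply/implyP => ji; rewrite MP.
Qed.

Lemma unitriangular_group_set : group_set unitriangular_set.
Proof.
apply/group_setP; split=> [|g h].
  by rewrite inE; apply/unitriangularP => i j _; rewrite GL_1E !mxE.
rewrite !inE => /unitriangularP gP /unitriangularP hP.
apply/unitriangularP => i j ji; rewrite GL_MxE mxE.
rewrite (bigD1 i) //= gP // eqxx mul1r hP // big1 ?addr0 // => l li.
have [lti | lei] := ltnP l i; first by rewrite gP ?(ltnW lti) // eq_sym (negPf li) mul0r.
have jl := leq_trans ji lei.
rewrite (hP _ _ jl) (_ : l == j = false) ?mulr0 //.
apply: contraNF li => /eqP lj; apply/eqP/val_inj/eqP.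
by rewrite eqn_leq lei andbT /= lj.
Qed.

Definition unitriangular_group : {group {'GL_d.+1[ 'F_p ]}} :=
  Group unitriangular_group_set.

End Unitriangular.

(* Main.v *)
Require Import Defs.
From mathcomp Require Import all_boot all_order all_algebra all_fingroup.
From mathcomp Require Import commutator boolp ring zify.

(** The subgroups that occur in the process are pattern subgroups: they consist
    of the matrices of [U] whose entries vanish outside of a set of positive
    roots, where the root (i, j), i < j, is the position of an entry and has
    height j - i. The simple roots (i, i + 1) and (d - 1 - i, d - i), mirror
    images of each other in the Dynkin diagram, form its layer i, and each stage
    of the process separates one more layer from the rest, from the outside of
    the diagram towards its middle.

    More precisely, as long as 2 k < d, the member of index n = (n_0, ..., n_k)
    of the filter of stage k, counted from 0, is the pattern subgroup of the
    roots that are [admissible] for n ([stage_pattern], [generated_filterE]): a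
    root of height more than n_0 is admissible, and a root of height n_0 is
    admissible if (n_1, ..., n_k) does not exceed lexicographically the number
    of simple roots that it involves from the layers 0, ..., k - 1, the
    components after the first nonzero number being unrestricted. The weights
    add up when roots do ([admissible_add]), which bounds the filter from above;
    conversely a root of height at least 2 splits into two smaller ones together
    with its index ([admissible_split]), so that the corresponding elementary
    matrices are commutators ([elementary_alpha]).

    It follows that L_(e1) has dimension m = d - 2 k over F_p, with a coordinate
    for each simple root outside of the first k layers, and that the
    commutation map is given by the determinants u_i v_(i+1) - u_(i+1) v_i
    ([stage_form]). For m > 2 an adjoint of this map has a matrix that is
    diagonal up to two entries, which send the second basis vector to the first
    and the last but one to the last ([adjoint_off_diag]). The diagonal
    entries are characters of the adjoint ring, and the operators with zero
    diagonal form an ideal of square zero; hence this ideal is the radical J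
    ([path_radicalE]), and L J is spanned by the first and the last basis
    vectors. Refining by J therefore separates the layer k, and yields the
    description of stage k + 1 ([refine_pattern]). For m = 1 the adjoint ring is
    F_p x F_p, for m = 2 it is the ring of matrices of order 2; both have zero
    radical, and the process stops at the stage k = (d - 1) / 2, rounded down.

    At this stage two roots that no index tells apart have the same height and
    the same outermost layer, so that they are equal or mirror images of each
    other. As consecutive members of the series differ by such roots, the
    quotients have order p or p^2 ([consecutive_factor]). *)

Set Implicit Arguments.
Unset Strict Implicit.
Unset Printing Implicit Defensive.

Import GroupScope GRing.Theory.

(** * Elements of the Jacobson radical *)

Section Radicals.

Local Open Scope ring_scope.

(** The annihilator of v is a maximal left ideal: if t v is not 0, then some r
    sends it back to v, and 1 - r t annihilates v. *)
Lemma radical_annihilates (R : pzRingType) (X : zmodType) (act : R -> X -> X)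
    (v : X) :
    (forall x, {morph act^~ x : r s / r + s}) ->
    (forall r s x, act (r * s) x = act r (act s x)) -> act 1 v = v ->
    v != 0 -> (forall r, act r 0 = 0) ->
    (forall w, w != 0 -> exists r, act r w = v) ->
  forall a, jacobson_radical a -> act a v = 0.
Proof.
move=> actD actM act1 v0 actr0 tr a /(_ [pred r | act r v == 0]) aJ.
have act0 x : act 0 x = 0 by apply: (addIr (act 0 x)); rewrite -actD !add0r.
have actN r x : act (- r) x = - act r x.
  by apply: (addIr (act r x)); rewrite -actD !addNr act0.
apply/eqP; apply: aJ; split.
- split=> [|r s t]; rewrite !inE ?act0 //= => /eqP sv /eqP tv.
  by rewrite actD actM sv tv actr0 addr0.
- by rewrite inE act1.
move=> T [T0 TD] T1 ST t Tt; rewrite inE; apply: contraNT T1 => tv.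
have [r rtv] := tr _ tv.
have -> : 1 = r * t + (1 - r * t) by rewrite addrC subrK.
apply: TD => //; apply: ST; rewrite inE actD actN actM rtv act1.
by rewrite subrr.
Qed.

(** If x is not in the maximal left ideal S, then 1 = r x + s for some s in S;
    but 1 - r x has the inverse 1 + r x. *)
Lemma square_zero_radical (R : pzRingType) (x : R) :
  (forall r, (r * x) * (r * x) = 0) -> jacobson_radical x.
Proof.
move=> x2 S [[S0 SD] S1 maxS]; apply: contraT => Sx.
pose T := [pred y | `[< exists r s, s \in S /\ y = r * x + s >]].
have Tx : x \in T.
  by rewrite inE; apply/asboolP; exists 1, 0; split; rewrite ?mul1r ?addr0.
have ST : {subset S <= T}.
  move=> s Ss; rewrite inE; apply/asboolP; exists 0, s; split=> //.
  by rewrite mul0r add0r.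
have TI : left_ideal T.
  split=> [|a y z]; first exact: ST.
  rewrite !inE => /asboolP[r [s [Ss ->]]] /asboolP[r' [s' [Ss' ->]]].
  apply/asboolP; exists (a * r + r'), (a * s + s').
  by split; [apply: SD | rewrite mulrDr mulrDl !mulrA addrACA].
have [T1 | T1] := boolP (1 \in T); last by rewrite (maxS T) in Sx.
have /asboolP[r [s [Ss rs1]]] := T1.
case/negP: S1; have -> : 1 = (1 + r * x) * s + 0.
  have -> : s = 1 - r * x by rewrite rs1 addrC addKr.
  by rewrite addr0 mulrBr mulr1 mulrDl mul1r x2 addr0 addrK.
exact: SD.
Qed.

(** A character makes F_p a simple module, whose nonzero vectors are moved onto
    each other by the multiples of 1. *)
Lemma character_radical (p : nat) (R : pzRingType) (chi : R -> 'F_p) :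
    {morph chi : r s / r + s} -> {morph chi : r s / r * s} -> chi 1 = 1 ->
  forall a, jacobson_radical a -> chi a = 0.
Proof.
move=> chiD chiM chi1 a aJ; rewrite -[chi a]mulr1; move: a aJ.
apply: (@radical_annihilates _ _ (fun r z => chi r * z)).
- by move=> z r s; rewrite chiD mulrDl.
- by move=> r s z; rewrite chiM mulrA.
- by rewrite chi1 mulr1.
- exact: oner_neq0.
- by move=> r; rewrite mulr0.
move=> w w0.
have chi0 : chi 0 = 0 by apply: (addIr (chi 0)); rewrite -chiD !add0r.
have chin n : chi n%:R = n%:R.
  by elim: n => [|n IHn]; rewrite ?mulr0n // !mulrS chiD chi1 IHn.
by exists (nat_of_ord w^-1)%:R; rewrite chin natr_Zp mulVf.
Qed.

End Radicals.

(** * The adjoint ring of a path form *)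

(** The alternating forms attached to the edges of a path with the vertices 0,
    ..., m - 1, each a hyperbolic plane on the two ends of its edge. *)
Record path_form (p m : nat) (V W : finZmodType) (b : biadditive V V W) :=
  PathForm {
    coord : nat -> V -> 'F_p;
    vec : nat -> V;
    target_coord : nat -> W -> 'F_p;
    coordD : forall i, {morph coord i : u v / (u + v)%R};
    coord_vec : forall i j, (i < m)%N -> (j < m)%N ->
      coord i (vec j) = (i == j)%:R%R;
    coord_inj :
      forall u v, (forall i, (i < m)%N -> coord i u = coord i v) -> u = v;
    target_coord_inj : forall w w',
      (forall i, (i.+1 < m)%N -> target_coord i w = target_coord i w') -> w = w';
    target_coordE : forall i u v, (i.+1 < m)%N ->
      target_coord i (b u v) =
      (coord i u * coord i.+1 v - coord i.+1 u * coord i v)%R }.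

Section PathForm.

Local Open Scope ring_scope.

Variables (p m : nat) (V W : finZmodType) (b : biadditive V V W).
Variable pf : path_form p m b.

Local Notation x := (coord pf).
Local Notation E := (vec pf).
Local Notation y := (target_coord pf).
Let xD := coordD pf.
Let xE := coord_vec pf.
Let x_inj := @coord_inj _ _ _ _ _ pf.
Let y_inj := @target_coord_inj _ _ _ _ _ pf.
Let yb := target_coordE pf.

Local Notation adj := (adjoint_ring b).
Local Notation fa a u := (adjoint_act u a).
Local Notation ga a v := (((val a).2 : endo V) v).
Local Notation F a i j := (x j (adjoint_act (E i) a)).
Local Notation G a i j := (x i (((val a).2 : endo V) (E j))).

Lemma coord0 i : x i 0 = 0.
Proof. by apply: (addIr (x i 0)); rewrite -xD !add0r. Qed.

Lemma coordMn i u n : x i (u *+ n) = x i u * n%:R.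
Proof.
by elim: n => [|n IHn]; rewrite ?mulr0n ?coord0 ?mulr0 // mulrS xD IHn -natr1;
  ring.
Qed.

Lemma mulrn_FpD (u : V) (s t : 'F_p) : u *+ nat_of_ord (s + t) = u *+ s + u *+ t.
Proof. by apply: x_inj => i im; rewrite xD !coordMn !natr_Zp mulrDr. Qed.

Lemma coord_sum i n (h : 'I_n -> V) : x i (\sum_j h j) = \sum_j x i (h j).
Proof. exact: (big_morph (x i) (xD i) (coord0 i)). Qed.

Lemma coord_expand u : u = \sum_(i < m) E i *+ x i u.
Proof.
apply: x_inj => j jm; rewrite coord_sum (bigD1 (Ordinal jm)) //=.
rewrite coordMn xE // eqxx mul1r natr_Zp big1 ?addr0 // => i ij.
rewrite coordMn xE // mulrC [j == i]eq_sym (_ : (i == j :> nat) = false) ?mulr0 //.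
by apply: contraNF ij => /eqP ij; apply/eqP/val_inj.
Qed.

Lemma endo_coord (f : endo V) i u :
  x i (f u) = \sum_(j < m) x j u * x i (f (E j)).
Proof.
have f0 : f 0 = 0 by apply: (addIr (f 0)); rewrite -endoD !add0r.
rewrite {1}(coord_expand u) (big_morph f (@endoD _ f) f0) coord_sum.
apply: eq_bigr => j _.
have fMn n v : f (v *+ n) = f v *+ n.
  by elim: n => [|n IHn]; rewrite ?mulr0n // !mulrS endoD IHn.
by rewrite fMn coordMn natr_Zp mulrC.
Qed.

Lemma adjointP (a : adj) u v : b (fa a u) v = b u (ga a v).
Proof. exact: (adjoint_pairP b (val a) (valP a)). Qed.

Lemma adjoint_actM (a c : adj) u : fa (a * c) u = fa c (fa a u).
Proof. by rewrite /adjoint_act rmorphM /= ffunE. Qed.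

Lemma adjoint_opM (a c : adj) u : ga (a * c) u = ga a (ga c u).
Proof. by rewrite rmorphM /= ffunE. Qed.

Lemma adjoint_actD (a c : adj) u : fa (a + c) u = fa a u + fa c u.
Proof. by rewrite /adjoint_act rmorphD /= ffunE. Qed.

Lemma adjoint_opD (a c : adj) u : ga (a + c) u = ga a u + ga c u.
Proof. by rewrite rmorphD /= ffunE. Qed.

Lemma adjoint_act0 u : fa (0 : adj) u = 0.
Proof. by rewrite /adjoint_act rmorph0 /= ffunE. Qed.

Lemma adjoint_op0 u : ga (0 : adj) u = 0.
Proof. by rewrite rmorph0 /= ffunE. Qed.

Lemma adjoint_act1 u : fa (1 : adj) u = u.
Proof. by rewrite /adjoint_act rmorph1 /= ffunE. Qed.

Lemma adjoint_op1 u : ga (1 : adj) u = u.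
Proof. by rewrite rmorph1 /= ffunE. Qed.

Lemma adjoint_ext (a c : adj) :
  (forall u, fa a u = fa c u) -> (forall u, ga a u = ga c u) -> a = c.
Proof.
rewrite /adjoint_act => ef eg; apply: val_inj.
case: (val a) (val c) ef eg => f g [f' g'] /= ef eg.
have -> : f = f' by apply/val_inj/ffunP.
by have -> : g = g' by apply: (@val_inj _ _ (endo V)); apply/ffunP.
Qed.

(** The condition on an adjoint pair, for two basis vectors and the form of the
    edge between k and k + 1. *)
Lemma adjoint_entry (a : adj) k i j :
    (k.+1 < m)%N -> (i < m)%N -> (j < m)%N ->
  F a i k * (k.+1 == j)%:R - F a i k.+1 * (k == j)%:R =
  (k == i)%:R * G a k.+1 j - (k.+1 == i)%:R * G a k j.
Proof.
move=> km im jm; have km' := ltnW km.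
have := congr1 (y k) (adjointP a (E i) (E j)); rewrite !yb // !xE //.
Qed.

Lemma adjoint_ring_of (f g : V -> V) :
    {morph f : u v / u + v} -> {morph g : u v / u + v} ->
    (forall u v, b (f u) v = b u (g v)) ->
  exists a : adj, (forall u, fa a u = f u) /\ (forall v, ga a v = g v).
Proof.
move=> fD gD fg.
have fE : additiveb (finfun f) by apply/additivebP => u v; rewrite !ffunE fD.
have gE : additiveb (finfun g) by apply/additivebP => u v; rewrite !ffunE gD.
have abP : adjoint_pair b (Endo fE, Endo gE : (endo V)^c).
  by apply/adjoint_pairP => u v; rewrite /= !ffunE.
exists (exist (fun fg => adjoint_pair b fg : Prop) _ abP).
by split=> u; rewrite /adjoint_act /= ffunE.
Qed.

(** The edge on either side of the vertex j forces the entry (i, j) to vanish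
    unless i is an end of that edge. An interior vertex j has edges on both
    sides, and only i = j is on both; an end of the path has just one edge. *)
Lemma adjoint_off_diag (a : adj) i j : (i < m)%N -> (j < m)%N -> i != j ->
  F a i j != 0 -> (i == 1%N) && (j == 0%N) || (i.+2 == m) && (j.+1 == m).
Proof.
move=> im jm ij; apply: contraNT => nex; apply/eqP.
have [/andP[j1 ij1]|] := boolP ((j.+1 < m)%N && (i != j.+1)).
  have := adjoint_entry a j1 im j1; rewrite eqxx [j == j.+1]eq_sym.
  rewrite (gtn_eqF (ltnSn j)) [j == i]eq_sym [j.+1 == i]eq_sym.
  by rewrite (negPf ij) (negPf ij1) !mulr0 !mul0r !subr0 mulr1.
have [j0|] := posnP j; first by lia.
case: j => // j in jm ij nex *; move=> _ nc; have ij1 : i != j by lia.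
have := adjoint_entry a jm im (ltnW jm); rewrite eqxx (gtn_eqF (ltnSn j)).
rewrite [j == i]eq_sym [j.+1 == i]eq_sym (negPf ij) (negPf ij1).
rewrite !mulr0 !mul0r mulr1 subr0 sub0r => /eqP.
by rewrite oppr_eq0 => /eqP.
Qed.

Lemma adjointM_entry (a c : adj) i j :
  F (a * c) i j = \sum_(l < m) F a i l * F c l j.
Proof. by rewrite adjoint_actM; apply: endo_coord. Qed.

(** A product of off-diagonal entries (i, l) and (l, i) would need both of them
    to be exceptional, which happens for m = 2 only. *)
Lemma adjoint_diagM (a c : adj) i : m != 2%N -> (i < m)%N ->
  F (a * c) i i = F a i i * F c i i.
Proof.
move=> m2 im; rewrite adjointM_entry (bigD1 (Ordinal im)) //= big1 ?addr0 // => l.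
rewrite -val_eqE /= => li; have lm := ltn_ord l.
have [-> | al] := eqVneq (F a i l) 0; first by rewrite mul0r.
have [-> | cl] := eqVneq (F c l i) 0; first by rewrite mulr0.
have il : i != l by rewrite eq_sym.
have := adjoint_off_diag im lm il al; have := adjoint_off_diag lm im li cl.
by lia.
Qed.

Lemma diag_radical (a : adj) i : m != 2%N -> (i < m)%N ->
  jacobson_radical a -> F a i i = 0.
Proof.
move=> m2 im; apply: (@character_radical p adj (fun r => F r i i)).
- by move=> r s; rewrite adjoint_actD xD.
- by move=> r s; rewrite adjoint_diagM.
by rewrite adjoint_act1 xE // eqxx.
Qed.

Lemma biadditive0l v : b 0 v = 0.
Proof. by apply: (addIr (b 0 v)); rewrite -biadditiveDl !add0r. Qed.

Lemma target_coord0 i : (i.+1 < m)%N -> y i 0 = 0.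
Proof. by move=> im; rewrite -(biadditive0l 0) yb // !coord0 !mul0r subr0. Qed.

Lemma path_nondegr v : (1 < m)%N -> (forall u, b u v = 0) -> v = 0.
Proof.
move=> m1 v0; apply: x_inj => i im; rewrite coord0.
case: i im => [|i] im.
  have := yb (E 1) v m1; rewrite v0 target_coord0 // !xE //= ?(ltnW m1) //.
  by move/eqP; rewrite mul0r mul1r sub0r eq_sym oppr_eq0 => /eqP.
have := yb (E i) v im; rewrite v0 target_coord0 // !xE ?(ltnW im) // eqxx.
by rewrite (gtn_eqF (ltnSn i)) mul0r mul1r subr0.
Qed.

Lemma path_nondegl u : (1 < m)%N -> (forall v, b u v = 0) -> u = 0.
Proof.
move=> m1 u0; apply: path_nondegr => // v; apply: y_inj => i im.
have := yb u v im; rewrite u0 target_coord0 // yb // => /eqP.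
by rewrite eq_sym subr_eq0 => /eqP e; rewrite mulrC -e mulrC subrr.
Qed.

(** By nondegeneracy, either component of an adjoint pair determines the
    other. *)
Lemma adjoint_act_eq0 (a : adj) : (1 < m)%N -> (forall u, fa a u = 0) -> a = 0.
Proof.
move=> m1 a0; apply: adjoint_ext => [u|u].
  by rewrite a0 adjoint_act0.
rewrite [LHS]path_nondegr //; last by move=> v; rewrite -adjointP a0 biadditive0l.
by rewrite adjoint_op0.
Qed.

Lemma adjoint_op_eq0 (a : adj) : (1 < m)%N -> (forall u, ga a u = 0) -> a = 0.
Proof.
move=> m1 a0; have b0 v : b v 0 = 0.
  by apply: (addIr (b v 0)); rewrite -biadditiveDr !add0r.
apply: adjoint_act_eq0 => // u; apply: path_nondegl => // v.
by rewrite adjointP a0.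
Qed.

(** Both components of an adjoint pair are scalars, each of them a character of
    the adjoint ring. *)
Lemma path_radical_dim1 (a : adj) : m = 1%N -> jacobson_radical a -> a = 0.
Proof.
move=> m1 aJ; have m0 : (0 < m)%N by rewrite m1.
have f0 : F a 0 0 = 0 by apply: diag_radical => //; rewrite m1.
have g0 : G a 0 0 = 0.
  move: aJ; apply: (@character_radical p adj (fun r => G r 0 0)).
  - by move=> r s; rewrite adjoint_opD xD.
  - move=> r s; rewrite adjoint_opM endo_coord.
    rewrite (bigD1 (Ordinal m0)) //= big1 ?addr0 1?mulrC // => l.
    by rewrite -val_eqE /=; have := ltn_ord l; rewrite {2}m1; case: (l : nat).
  by rewrite adjoint_op1 xE.
have e0 (f : endo V) u : x 0 (f (E 0)) = 0 -> f u = 0.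
  move=> fE; apply: x_inj => i im; have -> : i = 0%N by lia.
  rewrite endo_coord coord0 big1 // => l _.
  have -> : l = 0%N :> nat by have := ltn_ord l; lia.
  by rewrite fE mulr0.
by apply: adjoint_ext => u; rewrite ?adjoint_act0 ?adjoint_op0; apply: e0.
Qed.

(** There is a single, nondegenerate form, so that the pairs of the operators u
    -> b(u, v) z and w -> b(z, w) v are adjoint; for a suitable z they move a
    given nonzero vector w to v. *)
Lemma path_radical_dim2 (a : adj) : m = 2%N -> jacobson_radical a -> a = 0.
Proof.
move=> m2 aJ; have m1 : (1 < m)%N by rewrite m2.
have m0 : (0 < m)%N by rewrite m2.
apply: adjoint_op_eq0 => // v; have [->|v0] := eqVneq v 0.
  by apply: (addIr (ga a 0)); rewrite -endoD !add0r.
move: a aJ; apply: (@radical_annihilates adj V (fun r w => ga r w)) => //.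
- by move=> w r s; rewrite adjoint_opD.
- by move=> r s w; rewrite adjoint_opM.
- by rewrite adjoint_op1.
- by move=> r; apply: (addIr (ga r 0)); rewrite -endoD !add0r.
move=> w w0; have [z zw] : exists z, y 0 (b z w) = 1.
  have yb0 := fun u => yb u w m1.
  have [x0|x0] := eqVneq (x 0 w) 0.
    have x1 : x 1 w != 0.
      apply: contra_neq w0 => x1; apply: x_inj => i im; rewrite coord0.
      by have [->|->] : i = 0%N \/ i = 1%N by lia.
    exists (E 0 *+ nat_of_ord (x 1 w)^-1).
    by rewrite yb0 !coordMn !xE // natr_Zp x0 mul1r mulVf // mulr0 subr0.
  exists (E 1 *+ nat_of_ord (- (x 0 w)^-1)).
  by rewrite yb0 !coordMn !xE // natr_Zp /= !mul0r sub0r mul1r mulNr opprK mulVf.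
have [u u'|u u'|u u'|r [_ rg]] := @adjoint_ring_of
    (fun u => z *+ nat_of_ord (y 0 (b u v))) (fun u => v *+ nat_of_ord (y 0 (b z u))).
- by rewrite -mulrn_FpD !yb // !xD; congr (_ *+ nat_of_ord _); ring.
- by rewrite -mulrn_FpD !yb // !xD; congr (_ *+ nat_of_ord _); ring.
- apply: y_inj => i im; have -> : i = 0%N by lia.
  rewrite !yb // !coordMn !natr_Zp; ring.
exists r; rewrite rg zw; apply: x_inj => i im.
by rewrite coordMn natr_Zp mulr1.
Qed.

(** Two exceptional off-diagonal entries (i, l) and (l, j) cannot share the
    vertex l: for m > 2 an end of the path is not a neighbour of an end. *)
Lemma off_diag_mul (a c : adj) : (2 < m)%N ->
    (forall i, (i < m)%N -> F a i i = 0) ->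
    (forall i, (i < m)%N -> F c i i = 0) ->
  a * c = 0.
Proof.
move=> m2 a0 c0; apply: adjoint_act_eq0 => [|u]; first exact: ltnW.
apply: x_inj => j jm; rewrite coord0 [LHS]endo_coord big1 // => i _.
rewrite [X in _ * X](adjointM_entry a c) big1 ?mulr0 // => l _.
have [im lm] := (ltn_ord i, ltn_ord l).
have [-> | al] := eqVneq (F a i l) 0; first by rewrite mul0r.
have [-> | cl] := eqVneq (F c l j) 0; first by rewrite mulr0.
have il : i != l :> nat by apply: contra_neq al => ->; apply: a0.
have lj : l != j :> nat by apply: contra_neq cl => ->; apply: c0.
by have := adjoint_off_diag im lm il al; have := adjoint_off_diag lm jm lj cl; lia.
Qed.

Lemma path_radicalE (a : adj) : (2 < m)%N ->
  jacobson_radical a <-> forall i, (i < m)%N -> F a i i = 0.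
Proof.
move=> m2; split=> [aJ i im | a0].
  by apply: diag_radical => //; rewrite gtn_eqF.
apply: square_zero_radical => r.
by apply: off_diag_mul => // i im; rewrite adjoint_diagM ?a0 ?mulr0 // gtn_eqF.
Qed.

Lemma radical_image_inner (a : adj) u i : (2 < m)%N -> jacobson_radical a ->
  (0 < i)%N -> (i.+1 < m)%N -> x i (fa a u) = 0.
Proof.
move=> m2 /(path_radicalE _ m2) a0 i0 im.
rewrite [LHS]endo_coord big1 // => j _; have jm := ltn_ord j.
have [-> | aj] := eqVneq (F a j i) 0; first by rewrite mulr0.
have ji : j != i :> nat by apply: contra_neq aj => ->; apply/a0/ltnW.
by have := adjoint_off_diag jm (ltnW im) ji aj; lia.
Qed.

(** The operators that send a neighbour j of an end i of the path to i, and all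
    other basis vectors to 0; the second component of the pair is the
    opposite. *)
Lemma radical_elementary i j : (2 < m)%N ->
    (i == 0)%N && (j == 1)%N || (i.+1 == m) && (j.+2 == m) ->
  exists2 a : adj, jacobson_radical a &
    forall u, fa a u = E i *+ nat_of_ord (x j u).
Proof.
move=> m2 ij; have [im jm] : (i < m)%N /\ (j < m)%N by lia.
have [u u'|u u'|u u'|a [af _]] := @adjoint_ring_of
    (fun u => E i *+ nat_of_ord (x j u)) (fun u => E i *+ nat_of_ord (- x j u)).
- by rewrite xD mulrn_FpD.
- by rewrite xD opprD mulrn_FpD.
- apply: y_inj => l lm; have lm' := ltnW lm.
  rewrite !yb // !coordMn !natr_Zp !xE //.
  have [/andP[/eqP i0 /eqP j1] | /andP[/eqP i1 /eqP j2]] := orP ij.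
    by rewrite i0 j1; case: l lm lm' => [|l] lm lm' /=; ring.
  have [lj|lj] := eqVneq l j.
    have -> : l == i = false by lia.
    have -> : l.+1 == i by lia.
    by rewrite lj /=; ring.
  have -> : l == i = false by lia.
  have -> : l.+1 == i = false by lia.
  by rewrite /=; ring.
exists a => //; apply/path_radicalE => // l lm; rewrite af coordMn !xE // natr_Zp.
have [-> /=|il] := eqVneq l i; last by rewrite mul0r.
have -> : j == i = false by lia.
by rewrite mulr0.
Qed.

Lemma path_radical_neq0 : (2 < m)%N ->
  exists2 a : adj, jacobson_radical a & a != 0.
Proof.
move=> m2; have [|a aJ af] := @radical_elementary 0 1 m2; first by [].
exists a => //; apply/eqP => a0; have m0 : (0 < m)%N by lia.
have /eqP := congr1 (x 0) (af (E 1)); rewrite a0 adjoint_act0 coord0 coordMn.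
by rewrite natr_Zp !xE ?(ltnW m2) //= mul1r eq_sym oner_eq0.
Qed.

Lemma radical_image_outer u : (2 < m)%N ->
    (forall i, (0 < i)%N -> (i.+1 < m)%N -> x i u = 0) ->
  exists u1 u2 (a1 a2 : adj), [/\ jacobson_radical a1, jacobson_radical a2 &
    u = fa a1 u1 + fa a2 u2].
Proof.
move=> m2 u0; have m0 : (0 < m)%N by lia.
have [|a1 a1J a1f] := @radical_elementary 0 1 m2; first by [].
have [|a2 a2J a2f] := @radical_elementary m.-1 m.-2 m2; first by lia.
exists (E 1 *+ nat_of_ord (x 0 u)), (E m.-2 *+ nat_of_ord (x m.-1 u)), a1, a2.
split=> //; rewrite a1f a2f; apply: x_inj => i im; rewrite xD !coordMn !natr_Zp.
have [m1 m1' m2'] : [/\ (1 < m)%N, (m.-1 < m)%N & (m.-2 < m)%N]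
  by split; lia.
rewrite !xE // !eqxx !mul1r.
have [-> | i0] := eqVneq i 0%N.
  have -> : (0 == m.-1)%N = false by lia.
  by rewrite mul0r addr0 mul1r.
have [-> | i1] := eqVneq i m.-1; first by rewrite mul0r add0r mul1r.
have [i0' i1'] : (0 < i)%N /\ (i.+1 < m)%N by lia.
by rewrite !mul0r addr0 u0.
Qed.

Lemma ideal_exp1_radical (a : adj) : (2 < m)%N ->
  ideal_exp (@jacobson_radical adj) 1 a <-> jacobson_radical a.
Proof.
move=> m2; split=> [[n [r [s [rs ->]]]] | aJ]; last first.
  exists 1%N, (fun _ => 1), (fun _ => a); split=> // .
  by rewrite big_ord1 mul1r.
apply/path_radicalE => // i im; rewrite /adjoint_act.
elim/big_ind: _ => [|c c' cE c'E|j _]; first by rewrite -/(fa 0 _) adjoint_act0 coord0.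
  by rewrite -/(fa (c + c') _) adjoint_actD xD cE c'E addr0.
have [_ /(path_radicalE _ m2) s0] := rs j.
by rewrite -/(fa (r j * s j) _) adjoint_diagM ?s0 ?mulr0 // gtn_eqF.
Qed.

Lemma ideal_exp2_radical (a : adj) n : (2 < m)%N ->
  ideal_exp (@jacobson_radical adj) n.+2 a -> a = 0.
Proof.
move=> m2; elim: n a => [|n IHn] a [l [r [s [rs ->]]]]; apply: big1 => i _.
  have [/(ideal_exp1_radical _ m2)] := rs i.
  by move=> /(path_radicalE _ m2) r0 /(path_radicalE _ m2) s0; apply: off_diag_mul.
by have [/IHn -> _] := rs i; rewrite mul0r.
Qed.

End PathForm.

(** * Pattern subgroups of the unitriangular group *)

(** A faithful matrix representation of the ambient group of U that identifies U
    with the upper unitriangular matrices. The argument depends on the group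
    through such a representation only. *)
Record matrix_group (p d : nat) (gT : finGroupType) (U : {group gT}) :=
  MatrixGroup {
    rep :> gT -> 'M['F_p]_d.+1;
    rep_inj : injective rep;
    rep1 : rep 1 = 1%:M%R;
    repM : forall u v, rep (u * v) = (rep u *m rep v)%R;
    rep_unitri : forall g, (g \in U) = unitriangular (rep g);
    rep_onto : forall M, unitriangular M -> exists g, rep g = M }.

Arguments rep_inj {p d gT U} m.

Section Pattern.

Local Open Scope ring_scope.

Variables (p d : nat) (gT : finGroupType) (U : {group gT}).
Variable mx : matrix_group p d U.

Implicit Types (Q : rel nat) (g u v : gT).

Definition pattern (Q : rel nat) : {set gT} :=
  [set g | unitriangular (mx g) &&
    [forall i : 'I_d.+1, forall j : 'I_d.+1,
       (i < j)%N && ~~ Q i j ==> (mx g i j == 0)]].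

(** Closure under the addition of positive roots, which makes the pattern a
    subgroup, normal in U. *)
Definition root_ideal (Q : rel nat) := forall i i' j j',
  (i' <= i < j)%N -> (j <= j' <= d)%N -> Q i j -> Q i' j'.

Lemma patternP (Q : rel nat) (g : gT) :
  reflect ((forall i j : 'I_d.+1, (j <= i)%N -> mx g i j = (i == j)%:R) /\
           (forall i j : 'I_d.+1, (i < j)%N -> ~~ Q i j -> mx g i j = 0))
          (g \in pattern Q).
Proof.
rewrite inE; apply: (iffP andP) => -[/unitriangularP gU gQ]; split=> //.
  move=> i j ij nQ; have /forallP/(_ j)/implyP := forallP gQ i.
  by rewrite ij nQ => /(_ isT)/eqP.
apply/forallP => i; apply/forallP => j; apply/implyP => /andP[ij nQ].
by rewrite gQ.
Qed.

Lemma unitri_entry (g : gT) (i j : 'I_d.+1) : g \in U -> (j <= i)%N ->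
  mx g i j = (i == j)%:R.
Proof. by rewrite (rep_unitri mx) => /unitriangularP; apply. Qed.

Lemma pattern_entry Q (g : gT) (i j : 'I_d.+1) : g \in pattern Q -> (i < j)%N ->
  ~~ Q i j -> mx g i j = 0.
Proof. by case/patternP => _; apply. Qed.

Lemma pattern_sub Q : pattern Q \subset U.
Proof. by apply/subsetP => g; rewrite inE (rep_unitri mx) => /andP[]. Qed.

Lemma mem_pattern Q (g : gT) : g \in U ->
    (forall i j : 'I_d.+1, (i < j)%N -> mx g i j != 0 -> Q i j) ->
  g \in pattern Q.
Proof.
move=> gU gQ; apply/patternP; split=> [i j|i j ij]; first exact: unitri_entry.
by apply: contraNeq; apply: gQ.
Qed.

Lemma pattern_support Q (g : gT) (i j : 'I_d.+1) : g \in pattern Q -> (i < j)%N ->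
  mx g i j != 0 -> Q i j.
Proof. by move=> gQ ij; apply: contraNT; move/(pattern_entry gQ ij) ->. Qed.

Lemma patternS Q Q' :
    (forall i j, (i < j)%N -> (j <= d)%N -> Q i j -> Q' i j) ->
  pattern Q \subset pattern Q'.
Proof.
move=> QQ'; apply/subsetP => g gQ; apply: mem_pattern.
  exact: (subsetP (pattern_sub Q)).
by move=> i j ij /(pattern_support gQ ij); apply: QQ' => //; rewrite -ltnS.
Qed.

Lemma pattern_eq (Q Q' : rel nat) :
    (forall i j, (i < j)%N -> (j <= d)%N -> Q i j = Q' i j) ->
  pattern Q = pattern Q'.
Proof.
move=> QQ'; apply/eqP; rewrite eqEsubset.
by apply/andP; split; apply: patternS => i j ij jd; rewrite QQ'.
Qed.

Lemma unitri_mul_entry (u v : gT) (i j : 'I_d.+1) : u \in U -> v \in U ->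
    (i < j)%N ->
  mx (u * v)%g i j = mx u i j + mx v i j
    + \sum_(l : 'I_d.+1 | (i < l < j)%N) mx u i l * mx v l j.
Proof.
move=> uU vU ij; rewrite repM mxE (bigID (fun l : 'I_d.+1 => (i < l < j)%N)) /=.
rewrite addrC; congr (_ + _); have ji : j != i by rewrite -val_eqE /= gtn_eqF.
rewrite (bigD1 j) ?ltnn ?andbF //= (bigD1 i) /=; last by rewrite ltnn eq_sym.
rewrite (unitri_entry vU (leqnn _)) (unitri_entry uU (leqnn _)) !eqxx.
rewrite mulr1 mul1r big1 ?addr0 // => l /andP[/andP[nl lj] li].
have [il|li'] := ltnP i l.
  rewrite (unitri_entry vU) ?(negPf lj) ?mulr0 //.
  by move: nl; rewrite il /= -leqNgt.
by rewrite (unitri_entry uU) // eq_sym (negPf li) mul0r.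
Qed.

Lemma pattern_group_set Q : root_ideal Q -> group_set (pattern Q).
Proof.
move=> idQ; apply/group_setP; split=> [|u v uQ vQ].
  apply: mem_pattern; first exact: group1.
  move=> i j ij; have /negPf ij' : i != j by rewrite neq_ltn ij.
  by rewrite rep1 mxE ij' eqxx.
have uU := subsetP (pattern_sub Q) u uQ; have vU := subsetP (pattern_sub Q) v vQ.
apply: mem_pattern => [|i j ij]; first exact: groupM.
apply: contraNT => nQ; rewrite unitri_mul_entry //.
rewrite (pattern_entry uQ ij nQ) (pattern_entry vQ ij nQ) !add0r.
rewrite big1 // => l /andP[il lj]; rewrite (pattern_entry uQ il) ?mul0r //.
apply: contra nQ => Qil; apply: idQ Qil; rewrite ?leqnn ?il //.
by rewrite (ltnW lj) -ltnS /=.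
Qed.

Definition pattern_group Q (idQ : root_ideal Q) := Group (pattern_group_set idQ).

(** Here g is the commutator of u and v. Comparing entries in (v u) g = u v
    expresses g i j by products of entries of u and v at roots that add up to
    (i, j), and by entries of g that lie lower in the column j. The induction is
    on the height. *)
Lemma pattern_cofactor (Q1 Q2 Q3 : rel nat) u v w g : root_ideal Q3 ->
    (forall i l j, (i < l < j)%N -> (j <= d)%N -> Q1 i l -> Q2 l j -> Q3 i j) ->
    (forall i l j, (i < l < j)%N -> (j <= d)%N -> Q2 i l -> Q1 l j -> Q3 i j) ->
    u \in pattern Q1 -> v \in pattern Q2 -> w \in U -> g \in U ->
    w = (v * u)%g -> (w * g = u * v)%g ->
  g \in pattern Q3.
Proof.
move=> id3 Q12 Q21 uQ vQ wU gU Ew E; apply: (mem_pattern gU) => i j ij.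
have uU := subsetP (pattern_sub Q1) u uQ; have vU := subsetP (pattern_sub Q2) v vQ.
have jd : (j <= d)%N by rewrite -ltnS.
apply: contraNT.
have [n] := ubnP (j - i); elim: n i ij => // n IHn i ij; rewrite ltnS => jin nQ.
have := unitri_mul_entry wU gU ij; rewrite {}E => /(etrans (esym _)).
move=> /(_ _ (unitri_mul_entry uU vU ij)).
have := unitri_mul_entry vU uU ij; rewrite -{}Ew => ->.
rewrite [X in _ = _ + _ + X]big1 => [|l /andP[il lj]]; last first.
  have /eqP -> : mx g l j == 0; last by rewrite mulr0.
  apply: IHn; [by [] | by lia | ].
  by apply: contra nQ => Qlj; apply: id3 Qlj; rewrite ?(ltnW il) ?lj ?leqnn.
rewrite [X in _ = mx v i j + _ + X + _ + _]big1 => [|l /andP[il lj]]; last first.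
  have [-> | v0] := eqVneq (mx v i l) 0; first by rewrite mul0r.
  have [-> | u0] := eqVneq (mx u l j) 0; first by rewrite mulr0.
  case/negP: nQ; apply: (Q21 i l j); [by rewrite il|by []|..].
    exact: (pattern_support vQ).
  exact: (pattern_support uQ).
rewrite big1 => [|l /andP[il lj]]; last first.
  have [-> | u0] := eqVneq (mx u i l) 0; first by rewrite mul0r.
  have [-> | v0] := eqVneq (mx v l j) 0; first by rewrite mulr0.
  case/negP: nQ; apply: (Q12 i l j); [by rewrite il|by []|..].
    exact: (pattern_support uQ).
  exact: (pattern_support vQ).
rewrite !addr0 [mx v i j + _]addrC -[LHS]addr0 => /addrI/esym/eqP; exact.
Qed.

Lemma pattern_commutator (Q1 Q2 Q3 : rel nat) u v : root_ideal Q3 ->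
    (forall i l j, (i < l < j)%N -> (j <= d)%N -> Q1 i l -> Q2 l j -> Q3 i j) ->
    (forall i l j, (i < l < j)%N -> (j <= d)%N -> Q2 i l -> Q1 l j -> Q3 i j) ->
    u \in pattern Q1 -> v \in pattern Q2 ->
  [~ u, v]%g \in pattern Q3.
Proof.
move=> id3 Q12 Q21 uQ vQ.
have uU := subsetP (pattern_sub Q1) u uQ; have vU := subsetP (pattern_sub Q2) v vQ.
apply: (pattern_cofactor id3 Q12 Q21 uQ vQ (groupM vU uU) (groupR uU vU) erefl).
by rewrite commgEl conjgE !mulgA mulgK mulgV mul1g.
Qed.

Lemma pattern_comm_sub (Q1 Q2 Q3 : rel nat) : root_ideal Q3 ->
    (forall i l j, (i < l < j)%N -> (j <= d)%N -> Q1 i l -> Q2 l j -> Q3 i j) ->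
    (forall i l j, (i < l < j)%N -> (j <= d)%N -> Q2 i l -> Q1 l j -> Q3 i j) ->
  [~: pattern Q1, pattern Q2] \subset pattern Q3.
Proof.
move=> id3 Q12 Q21; rewrite -[pattern Q3]/(pattern_group id3 : {set _}) gen_subG.
apply/subsetP => _ /imset2P[u v uQ vQ ->].
exact: (pattern_commutator id3 Q12 Q21).
Qed.

Lemma patternT : pattern (fun _ _ => true) = U.
Proof.
apply/eqP; rewrite eqEsubset pattern_sub; apply/subsetP => g gU.
exact: mem_pattern.
Qed.

Implicit Types (i j l : 'I_d.+1) (c : 'F_p) (M : 'M['F_p]_d.+1).

Definition unitri_of M : gT := odflt 1%g [pick g | mx g == M].

Lemma unitri_ofE M : unitriangular M -> mx (unitri_of M) = M.
Proof.
move=> /(rep_onto mx)[g gM]; rewrite /unitri_of.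
by case: pickP => [h /eqP | /(_ g)] //; rewrite gM eqxx.
Qed.

Lemma unitri_of_in M : unitriangular M -> unitri_of M \in U.
Proof. by move=> MU; rewrite (rep_unitri mx) unitri_ofE. Qed.

Definition elementary (i j : 'I_d.+1) (c : 'F_p) : gT :=
  unitri_of (1%:M + c *: delta_mx i j).

Lemma elementary_unitri (i j : 'I_d.+1) (c : 'F_p) : (i < j)%N ->
  unitriangular (1%:M + c *: delta_mx i j).
Proof.
move=> ij; apply/unitriangularP => a b ba; rewrite !mxE.
have [/andP[/eqP ai /eqP bj]|_] := boolP ((a == i) && (b == j)).
  by rewrite ai bj leqNgt ij in ba.
by rewrite mulr0 addr0.
Qed.

Lemma elementary_in i j c : (i < j)%N -> elementary i j c \in U.
Proof. by move=> ij; apply/unitri_of_in/elementary_unitri. Qed.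

Lemma elementaryE i j c (a b : 'I_d.+1) : (i < j)%N ->
  mx (elementary i j c) a b = (a == b)%:R + c * ((a == i) && (b == j))%:R.
Proof. by move=> ij; rewrite unitri_ofE ?elementary_unitri // !mxE. Qed.

Lemma elementary_pattern Q i j c : (i < j)%N -> Q i j ->
  elementary i j c \in pattern Q.
Proof.
move=> ij Qij; apply: mem_pattern; first exact: elementary_in.
move=> a b ab; rewrite elementaryE //; have /negPf -> : a != b by rewrite neq_ltn ab.
have [/andP[/eqP-> /eqP->] //|_] := boolP (_ && _).
by rewrite mulr0 addr0 eqxx.
Qed.

Lemma elementary_mul i j c g (a b : 'I_d.+1) : (i < j)%N ->
  mx (elementary i j c * g)%g a b = mx g a b + (a == i)%:R * c * mx g j b.
Proof.
move=> ij; rewrite repM unitri_ofE ?elementary_unitri // mulmxDl mul1mx mxE.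
congr (_ + _); rewrite -scalemxAl mxE mulrC mxE (bigD1 j) //= big1 ?addr0.
  rewrite mxE eqxx andbT; ring.
by move=> l /negPf lj; rewrite mxE lj andbF mul0r.
Qed.

Lemma rep_commutator g u v (A B C : 'M['F_p]_d.+1) :
    mx u = A -> mx v = B -> mx g = C -> B *m A *m C = A *m B ->
  [~ u, v]%g = g.
Proof.
move=> <- <- <- E; apply: (mulgI (v * u)%g).
rewrite commgEl conjgE !mulgA mulgK mulgV mul1g; apply: (rep_inj mx).
by rewrite !repM E.
Qed.

Lemma elementary_commutator i l j c : (i < l < j)%N ->
  [~ elementary i l c, elementary l j 1%R]%g = elementary i j c.
Proof.
move=> /andP[il lj]; have ij := ltn_trans il lj.
apply: (rep_commutator (unitri_ofE (elementary_unitri c il))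
  (unitri_ofE (elementary_unitri 1 lj)) (unitri_ofE (elementary_unitri c ij))).
have jii : (j == i) = false by apply/negP => /eqP e; rewrite e ltnn in ij.
have lii : (l == i) = false by apply/negP => /eqP e; rewrite e ltnn in il.
have il0 : delta_mx i l *m delta_mx i j = 0 :> 'M['F_p]_d.+1.
  by rewrite mul_delta_mx_cond lii.
have lj0 : delta_mx l j *m delta_mx i j = 0 :> 'M['F_p]_d.+1.
  by rewrite mul_delta_mx_cond jii.
have lji : delta_mx l j *m delta_mx i l = 0 :> 'M['F_p]_d.+1.
  by rewrite mul_delta_mx_cond jii.
have ilj : delta_mx i l *m delta_mx l j = delta_mx i j :> 'M['F_p]_d.+1.
  by rewrite mul_delta_mx_cond eqxx.
rewrite scale1r !mulmxDl !mulmxDr !mul1mx !mulmx1 -!scalemxAl -!scalemxAr.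
rewrite lji ilj scaler0 addr0 !mulmxDl mul1mx -scalemxAl il0 lj0 !scaler0 !addr0.
by rewrite addrAC !addrA; congr (_ + _); rewrite addrAC.
Qed.

(** If (i, j) is a nonzero entry in the last nontrivial row i, then the row j of
    g is trivial, and so multiplying g by an elementary matrix on the left
    clears this entry and changes no other. *)
Lemma elementary_gen (H : {group gT}) g : g \in U ->
    (forall i j c, (i < j)%N -> mx g i j != 0 -> elementary i j c \in H) ->
  g \in H.
Proof.
pose S g := [set ij : 'I_d.+1 * 'I_d.+1 |
               (ij.1 < ij.2)%N && (mx g ij.1 ij.2 != 0)].
have [n] := ubnP #|S g|; elim: n g => // n IHn g; rewrite ltnS => Sn gU gH.
have [S0 | [ij0 S0]] := set_0Vmem (S g).
  suff -> : g = 1%g by [].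
  apply: (rep_inj mx); apply/matrixP => i j; rewrite rep1 [RHS]mxE.
  have [ji|ij] := leqP j i; first exact: unitri_entry.
  have /negPf-> : i != j by rewrite neq_ltn ij.
  apply/eqP; apply: contraT => gij.
  by have := in_set0 (i, j); rewrite -S0 inE /= ij gij.
have [ij Sij ijM] := @arg_maxnP _ ij0 (mem (S g)) (fun ij => nat_of_ord ij.1) S0.
have {ij0 S0} := Sij; case: ij Sij ijM => i j /= Sij ijM.
rewrite inE /= => /andP[ij gij].
pose g' := (elementary i j (- mx g i j) * g)%g.
have row_j b : mx g j b = (j == b)%:R.
  have [bj|jb] := leqP b j; first exact: unitri_entry.
  have /negPf-> : j != b by rewrite neq_ltn jb.
  apply/eqP; apply: contraTT ij => gjb; rewrite -leqNgt.
  by have /= := ijM (j, b); apply; rewrite inE /= jb.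
have g'E a b : mx g' a b = if (a == i) && (b == j) then 0 else mx g a b.
  rewrite elementary_mul // row_j [j == b]eq_sym.
  have [->|_] /= := eqVneq a i; last by rewrite !mul0r addr0.
  by have [->|_] /= := eqVneq b j; [rewrite mul1r mulr1 subrr | rewrite mulr0 addr0].
have g'H : g' \in H.
  apply: IHn => [||a b c ab].
  - apply: leq_trans Sn; apply: proper_card; apply/properP; split.
      apply/subsetP => -[a b]; rewrite !inE g'E /=.
      by case: ifP; rewrite ?eqxx ?andbF.
    by exists (i, j); rewrite // inE g'E !eqxx andbF.
  - by rewrite groupM ?elementary_in.
  by rewrite g'E; case: ifP; rewrite ?eqxx // => _; apply: gH.
rewrite -(mulKg (elementary i j (- mx g i j)) g) groupM // groupV.
exact: gH.
Qed.

Lemma card_pattern Q : prime p ->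
  #|pattern Q| = (p ^ #|[set ij : 'I_d.+1 * 'I_d.+1 |
                          (ij.1 < ij.2) && Q ij.1 ij.2]|)%N.
Proof.
move=> p_pr; set D := [set ij | _].
rewrite -{1}(card_Fp p_pr) -(card_pffun_on (0 : 'F_p) D 'F_p).
pose phi g := [ffun ij : 'I_d.+1 * 'I_d.+1 =>
  if (ij.1 < ij.2)%N then mx g ij.1 ij.2 else 0].
have phi_inj : {in pattern Q &, injective phi}.
  move=> g h gQ hQ gh; apply: (rep_inj mx); apply/matrixP => i j.
  have [ji|ij] := leqP j i.
    by rewrite [LHS](unitri_entry (subsetP (pattern_sub Q) g gQ) ji)
       [RHS](unitri_entry (subsetP (pattern_sub Q) h hQ) ji).
  by have /ffunP/(_ (i, j)) := gh; rewrite !ffunE /= ij.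
rewrite -(card_in_imset phi_inj); apply: eq_card => f.
apply/imsetP/pffun_onP => [[g gQ ->] | [fD _]]; first split=> //.
  apply/subsetP => -[i j]; rewrite !inE ffunE /=.
  by case: ifP; rewrite ?eqxx // => ij; apply: pattern_support.
pose M := \matrix_(i < d.+1, j < d.+1) if (i < j)%N then f (i, j) else (i == j)%:R.
have MU : unitriangular M.
  by apply/unitriangularP => i j ji; rewrite mxE ltnNge ji.
exists (unitri_of M).
  apply: mem_pattern => [|i j ij]; first exact: unitri_of_in.
  rewrite unitri_ofE // mxE ij => fij.
  by have := subsetP fD (i, j) fij; rewrite inE => /andP[].
apply/ffunP => -[i j]; rewrite ffunE unitri_ofE // mxE /=.
case: ltnP => // ji; apply/eqP; apply: contraT => fij.
by have := subsetP fD (i, j) fij; rewrite inE /= ltnNge ji.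
Qed.

End Pattern.

(** * Roots and their weights *)

Section Weights.

Variables (d k : nat).
Implicit Types (n a b : nat ^ k.+1) (i j l : nat).

(** The constraint on n_l for l up to min(i, d - j) + 1 expresses that (n_1,
    ..., n_k) is at most the weight of the root: the simple root (a, a + 1) is
    in the layer min(a, d - 1 - a), so that the root (i, j) involves none from
    the layers below t = min(i, d - j), and from the layer t it involves (a, a +
    1) for a = t if i = t, and for a = d - 1 - t if d - j = t; these two are
    distinct if t < k and 2 k < d. The layer l - 1 corresponds to n_l. *)
Definition admissible n : rel nat := fun i j =>
  (n ord0 < j - i) ||
  (n ord0 == j - i) &&
    [forall l : 'I_k.+1, (0 < l) && (l <= (minn i (d - j)).+1) ==>
       (n l <= (i < l) + (d - j < l))].

Lemma admissibleP n i j : reflect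
  (n ord0 < j - i \/ n ord0 = j - i /\ forall l : 'I_k.+1, 0 < l ->
     l <= i.+1 -> l <= (d - j).+1 -> n l <= (i < l) + (d - j < l))
  (admissible n i j).
Proof.
apply: (iffP orP) => -[->|]; try by left.
  move=> /andP[/eqP nij /forallP nl]; right; split=> // l l0 li lj.
  by have := implyP (nl l); apply; rewrite l0 /= -minnSS leq_min li.
move=> [-> nl]; right; rewrite eqxx; apply/forallP => l; apply/implyP.
by rewrite -minnSS leq_min => /and3P[l0 li lj]; apply: nl.
Qed.

Lemma in_SE n : in_S n = (n ord0 < 2).
Proof.
apply/idP/idP; last exact: in_SI.
move/Order.TupleLexiOrder.ltxi_tuplePlt => [i _].
rewrite !tnth_mktuple !ffunE; by have [->|_] := eqVneq i ord0.
Qed.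

Lemma admissible_ideal n : root_ideal d (admissible n).
Proof.
move=> i i' j j' /andP[ii' ij] /andP[jj' jd] /admissibleP nij; apply/admissibleP.
have [<-|ni] := eqVneq i i'; last by left; lia.
by have [<- //|nj] := eqVneq j j'; left; lia.
Qed.

(** The layers of a root are those of its two parts. If l splits (i, j), then
    for x <= min(i, d - j) + 1 the left part can only contribute to n_x through
    i, and the right part only through j. *)
Lemma admissible_add a b i l j : i < l < j -> j <= d ->
  admissible a i l -> admissible b l j -> admissible (a + b)%R i j.
Proof.
move=> /andP[il lj] jd /admissibleP ail /admissibleP blj; apply/admissibleP.
have abE x : (a + b)%R x = a x + b x by rewrite ffunE.
rewrite !abE; case: ail blj => [a0|[a0 al]] [b0|[b0 bl]]; try by left; lia.
right; split=> [|x x0 xi xj]; first lia.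
rewrite abE; have := al x x0 xi; have := bl x x0; lia.
Qed.

(** The index follows the simple roots. If n_0 < j - i there is room to spare,
    and the part (i, i + 1) takes all of (n_1, ..., n_k). Otherwise, the
    components after the decisive one being unrestricted, (n_1, ..., n_k) may go
    to the part that holds the outermost simple root; if both parts do, that is
    for i = d - j, the component i + 1, which is at most 2, is shared between
    them. *)
Lemma admissible_split n i j : i.+1 < j -> j <= d -> admissible n i j ->
  exists a b, [/\ n = (a + b)%R, admissible a i i.+1 & admissible b i.+1 j].
Proof.
move=> ij jd /admissibleP[nij | [n0 nl]].
  exists [ffun l => if l == ord0 then 0 else n l],
         [ffun l => if l == ord0 then n ord0 else 0]; split.
  - apply/ffunP => l; rewrite !ffunE.
    by have [->|_] := eqVneq l ord0; rewrite /= ?add0r ?addr0.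
  - by apply/admissibleP; left; rewrite ffunE eqxx; lia.
  apply/admissibleP; rewrite ffunE eqxx; have [|h] := ltnP (n ord0) (j - i.+1).
    by left.
  right; split=> [|l l0 _ _]; first lia.
  by rewrite ffunE -val_eqE gtn_eqF.
have [N nN] : exists N : 'I_k.+1 -> nat, forall l : 'I_k.+1, n l = N l by exists n.
pose f l m : nat := (if l == 0 then 1 else if i < d - j then m else
              if d - j < i then 0 else minn m 1)%N.
exists [ffun l : 'I_k.+1 => f l (n l)], [ffun l : 'I_k.+1 => n l - f l (n l)]; split.
- apply/ffunP => l; rewrite !ffunE -[RHS]/(addn _ _) /f; have [l0|l0] := eqVneq (l : nat) 0.
    have -> : l = ord0 by apply: val_inj.
    by rewrite /= [n _]n0; lia.
  by rewrite /=; do 2?[case: ifP => ?]; lia.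
- apply/admissibleP; right; rewrite ffunE /f /=; split=> [|l l0 li lj]; first lia.
  rewrite ffunE gtn_eqF //; have [lj'|lj'] := leqP l (d - j).+1.
    by have := nl l l0 li lj'; rewrite !nN; do 2?[case: ifP => ?]; lia.
  by do 2?[case: ifP => ?]; lia.
apply/admissibleP; right; rewrite ffunE /f /=.
split=> [|l l0 li lj]; first by rewrite [n _]n0; lia.
rewrite ffunE gtn_eqF //; have [li'|li'] := leqP l i.+1.
  by have := nl l l0 li' lj; rewrite !nN; do 2?[case: ifP => ?]; lia.
by do 2?[case: ifP => ?]; lia.
Qed.

(** The roots of the boundary at an index (m, 0, ..., 0): moving on to a larger
    index excludes exactly the roots of height m outside of the first k layers,
    whose weight is 0. *)
Definition boundary_root m : rel nat := fun i j =>
  (m < j - i) || (m == j - i) && (minn i (d - j) < k).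

Lemma boundary_root_ideal m : root_ideal d (boundary_root m).
Proof. by move=> i i' j j'; rewrite /boundary_root; lia. Qed.

End Weights.

Arguments admissible_ideal d {k} n.
Arguments boundary_root_ideal d k m : clear implicits.

Section Chain.

Variables (d k : nat).
Implicit Types (n m : nat ^ k.+1) (i j : nat).

(** The sets of admissible roots form a chain, since each consists of the roots
    of weight at least n in a linear preorder. *)
Lemma admissible_total m n i j i' j' : i < j <= d -> i' < j' <= d ->
  admissible d m i j -> ~~ admissible d n i j -> admissible d n i' j' ->
  admissible d m i' j'.
Proof.
move=> ijd ijd' /admissibleP mij /admissibleP nij /admissibleP nij'; apply/admissibleP.
have [lt_h | ge_h] := ltnP (m ord0) (j' - i'); [by left | right].
have le_n : j - i <= n ord0.
  by rewrite leqNgt; apply/negP => lt_n; apply: nij; left.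
case: mij nij' => [lt_m | [m0 ml]] [lt_n | [n0 nl]]; try by lia.
have [tt | tt] := boolP ((minn i (d - j) < minn i' (d - j')) ||
    (minn i (d - j) == minn i' (d - j')) && ((i' == d - j') <= (i == d - j))).
  case: nij; right; split=> [|l l0 li lj]; first by lia.
  have [li' lj'] : l <= i'.+1 /\ l <= (d - j').+1 by lia.
  by apply: leq_trans (nl l l0 li' lj') _; lia.
split=> [|l l0 li' lj']; first by lia.
have [li lj] : l <= i.+1 /\ l <= (d - j).+1 by lia.
by apply: leq_trans (ml l l0 li lj) _; lia.
Qed.

(** The index that separates the roots is (j' - i', 0, ..., 0) in the first
    case, and in the second one (j - i, 0, ..., 1, ..., 0), with the 1 at the
    component of the outermost layer of (i', j'). *)
Lemma admissible_separate i j i' j' : i < j <= d -> i' < j' <= d ->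
    j - i < j' - i' \/ j - i = j' - i' /\
      minn k (minn i' (d - j')) < minn k (minn i (d - j)) ->
  exists2 n : nat ^ k.+1, admissible d n i' j' & ~~ admissible d n i j.
Proof.
move=> /andP[ij jd] /andP[ij' jd'] [hh | [hh tt]].
  exists [ffun l => if l == ord0 then (j' - i')%N else 0%N].
    apply/admissibleP; right; rewrite ffunE eqxx; split=> // l l0 _ _.
    by rewrite ffunE -val_eqE gtn_eqF.
  apply/negP => /admissibleP; rewrite ffunE eqxx; lia.
have tk : ((minn i' (d - j')).+1 < k.+1)%N by lia.
pose x0 := Ordinal tk.
have x00 : x0 != ord0 by [].
exists [ffun l => if l == ord0 then (j - i)%N else (l == x0 : nat)].
  apply/admissibleP; right; rewrite ffunE eqxx; split=> // l l0 li lj.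
  by rewrite ffunE -!val_eqE gtn_eqF //=; lia.
apply/negP => /admissibleP; rewrite ffunE eqxx => -[|[_ al]]; first by rewrite ltnn.
have := al x0 isT; rewrite ffunE (negPf x00) eqxx /=.
have [t1 t2] : (minn i' (d - j')).+1 <= i.+1 /\ (minn i' (d - j')).+1 <= (d - j).+1.
  by lia.
by move=> /(_ t1 t2); lia.
Qed.

End Chain.

(** * Generated filters and their boundaries *)

Section Filter.

Local Open Scope group_scope.

Variables (p d k : nat) (gT : finGroupType) (U : {group gT}).
Variable (mx : matrix_group p d U) (pi : prefilter U k).
Hypothesis pi_pattern : forall n,
  in_S n -> pi n = pattern mx (admissible d n) :> {set gT}.

Local Notation alpha := (generated_filter pi).

Lemma path_commutator_pattern s q : all in_S (s :: q) ->
  path_commutator pi s q \subset pattern mx (admissible d (\sum_(t <- s :: q) t)%R).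
Proof.
elim/last_ind: q => [|q t IHq] Ssq.
  by rewrite big_seq1 /path_commutator /= pi_pattern //; case/andP: Ssq.
rewrite /path_commutator foldl_rcons -rcons_cons -cats1 big_cat /= big_seq1.
move: Ssq; rewrite -rcons_cons all_rcons => /andP[St /IHq sq].
apply: subset_trans (commgSS sq (_ : _ \subset pattern mx (admissible d t))) _.
  by rewrite pi_pattern.
apply: pattern_comm_sub; first exact: admissible_ideal.
  exact: admissible_add.
by move=> i l j ilj jd; rewrite addrC; apply: admissible_add.
Qed.

(** A commutator of two elementary matrices is an elementary matrix, and the
    splitting of roots and indices reduces the claim to simple roots, for which
    n is an index of the prefilter. *)
Lemma elementary_alpha n (i j : 'I_d.+1) c : (i < j)%N -> admissible d n i j ->
  elementary mx i j c \in alpha n.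
Proof.
have [m] := ubnP (j - i); elim: m n i j c => // m IHm n i j c jim ij nij.
have jd : (j <= d)%N by rewrite -ltnS.
have [ij1|ij1] := ltnP i.+1 j; last first.
  have Sn : in_S n by rewrite in_SE; move/admissibleP: nij; lia.
  have := @path_sub_generated _ _ _ pi n [::] n.
  rewrite big_seq1 /= Sn /path_commutator /= pi_pattern // => /(_ isT erefl).
  by move/subsetP; apply; apply: elementary_pattern.
have [a [b [-> ai bj]]] := admissible_split ij1 jd nij.
have i1d : (i.+1 < d.+1)%N by lia.
pose l := Ordinal i1d; have il : (i < l < j)%N by rewrite /= leqnn.
rewrite -(elementary_commutator mx c il).
apply: (subsetP (generated_filter_comm pi a b)); apply: mem_commg.
  by apply: IHm => //=; lia.
by apply: IHm => //=; lia.
Qed.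

Lemma generated_filterE n : alpha n = pattern mx (admissible d n) :> {set gT}.
Proof.
apply/eqP; rewrite eqEsubset; apply/andP; split.
  rewrite -[pattern _ _]/(gval (pattern_group mx (admissible_ideal d n))) gen_subG.
  apply/subsetP => x; rewrite inE => /asboolP[s [q [Ssq <- xsq]]].
  exact: (subsetP (path_commutator_pattern Ssq)).
apply/subsetP => g gn; apply: (@elementary_gen _ _ _ _ mx).
  exact: (subsetP (pattern_sub mx _) g gn).
by move=> i j c ij gij; apply: elementary_alpha => //; apply: pattern_support gij.
Qed.

Lemma boundaryE (n : nat ^ k.+1) :
    (0 < n ord0)%N -> (forall l, l != ord0 -> n l = 0%N) ->
  boundary pi n = pattern mx (boundary_root d k (n ord0)) :> {set gT}.
Proof.
move=> n0 nl; apply/eqP; rewrite eqEsubset; apply/andP; split.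
  rewrite -[pattern _ _]/(gval (pattern_group mx (boundary_root_ideal d k (n ord0)))).
  rewrite gen_subG; apply/subsetP => x; rewrite inE => /asboolP[s s0].
  rewrite generated_filterE; apply/subsetP: x; apply: patternS => i j ij jd.
  have nsE x : (n + s)%R x = (n x + s x)%N by rewrite ffunE.
  move/admissibleP; rewrite nsE /boundary_root => -[|[h al]]; first by lia.
  have [s00|s00] := posnP (s ord0); last by lia.
  have [l sl] : exists l, s l != 0%N.
    apply/existsP; apply: contraT; rewrite negb_exists => /forallP s1.
    case/eqP: s0; apply/ffunP => l; rewrite ffunE; apply/eqP.
    exact: negbNE (s1 l).
  have l0 : l != ord0 by apply: contraNneq sl => ->; rewrite s00.
  have l0' : (0 < l)%N by rewrite lt0n.
  have := al l l0'; rewrite nsE nl // add0n; have := ltn_ord l.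
  have [li|li] := leqP l i.+1; last by lia.
  have [lj|lj] := leqP l (d - j).+1; last by lia.
  by move=> lk /(_ isT isT); lia.
apply/subsetP => g gn; apply: (@elementary_gen _ _ _ _ mx).
  exact: (subsetP (pattern_sub mx _) g gn).
move=> i j c ij gij; have jd : (j <= d)%N by rewrite -ltnS.
have /orP[h|/andP[/eqP h tk]] := pattern_support gn ij gij.
  apply: (subsetP (sub_boundary pi n (e1_neq0 k))); apply: elementary_alpha => //.
  have neE x : (n + e1)%R x = (n x + (x == ord0))%N by rewrite !ffunE.
  apply/admissibleP; rewrite neE eqxx; have [h1|h1] := ltnP (n ord0).+1 (j - i).
    by left; lia.
  right; split=> [|l l0 _ _]; first by lia.
  have l0' : l != ord0 by rewrite -val_eqE -lt0n.
  by rewrite neE nl // (negPf l0').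
have tk1 : ((minn i (d - j)).+1 < k.+1)%N by [].
pose x0 := Ordinal tk1.
pose s : nat ^ k.+1 := [ffun l => (l == x0 : nat)].
have s0 : (s != 0)%R.
  by apply/eqP => /ffunP/(_ x0); rewrite !ffunE eqxx.
apply: (subsetP (sub_boundary pi n s0)); apply: elementary_alpha => //.
have nsE x : (n + s)%R x = (n x + (x == x0))%N by rewrite !ffunE.
apply/admissibleP; right; rewrite nsE; split=> [|l l0 li lj].
  by rewrite (_ : ord0 == x0 = false) ?addn0.
rewrite nsE nl; last by rewrite -val_eqE -lt0n.
by rewrite -val_eqE /=; lia.
Qed.

End Filter.

(** * Orders of the factors *)

Section Factors.

Variables (p d k : nat) (gT : finGroupType) (U : {group gT}).
Variable (mx : matrix_group p d U) (pi : prefilter U k).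
Hypothesis p_pr : prime p.
Hypothesis pi_pattern : forall n,
  in_S n -> pi n = pattern mx (admissible d n) :> {set gT}.

Lemma pattern_proper (Q Q' : rel nat) (i j : 'I_d.+1) : (i < j)%N ->
    (forall i' j', (i' < j')%N -> (j' <= d)%N -> Q i' j' -> Q' i' j') ->
    Q' i j -> ~~ Q i j ->
  pattern mx Q \proper pattern mx Q'.
Proof.
move=> ij QQ' Q'ij nQ; rewrite properE patternS //; apply/subsetPn.
exists (elementary mx i j 1%R); first exact: elementary_pattern.
apply/negP => /pattern_support /(_ ij); rewrite elementaryE // !eqxx.
have /negPf -> : i != j by rewrite neq_ltn ij.
by rewrite mulr1 add0r oner_neq0 => /(_ isT); apply/negP.
Qed.

(** No admissible set separates two of the roots that lie between A and B. So
    they have the same height h and the same value of min(k, i, d - j); as the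
    sum of i and d - j is d - h < 2 k + 2, these numbers determine the pair {i,
    d - j}, that is, the root up to its mirror image. *)
Lemma consecutive_factor (A B : {group gT}) : (d <= k.*2.+2)%N ->
    consecutive (generated_filter pi) A B ->
  #|A / B| = p \/ #|A / B| = (p ^ 2)%N.
Proof.
move=> dk [[m Am] [n Bn] BA nAB].
have AE : A = pattern mx (admissible d m) :> {set gT}.
  by rewrite -Am (generated_filterE pi_pattern).
have BE : B = pattern mx (admissible d n) :> {set gT}.
  by rewrite -Bn (generated_filterE pi_pattern).
pose S (n : nat ^ k.+1) := [set ij : 'I_d.+1 * 'I_d.+1 |
  (ij.1 < ij.2)%N && admissible d n ij.1 ij.2].
have ijd (i j : 'I_d.+1) : (i < j)%N -> (i < j <= d)%N.
  by move=> ->; rewrite -ltnS /=.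
have chain (a b : nat ^ k.+1) (i j : 'I_d.+1) : (i < j)%N ->
    admissible d a i j -> ~~ admissible d b i j ->
    pattern mx (admissible d b) \proper pattern mx (admissible d a).
  move=> ij aij bij; apply: (pattern_proper ij _ aij bij) => i' j' ij' jd'.
  by apply: (admissible_total (ijd _ _ ij) _ aij bij); rewrite ij'.
have [i [j [ij mij nij]]] : exists i j : 'I_d.+1,
    [/\ (i < j)%N, admissible d m i j & ~~ admissible d n i j].
  have /properP[_ [g]] := BA; rewrite AE BE => gm gn.
  have [|/exists_inPn] := boolP [exists ij in S m, ~~ admissible d n ij.1 ij.2].
    by case/exists_inP => -[i j]; rewrite inE => /andP[/= ij mij] nij; exists i, j.
  move=> mn; case/negP: gn; apply: (mem_pattern (subsetP (pattern_sub mx _) g gm)).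
  move=> i j ij gij; have := mn (i, j); rewrite inE /= ij negbK; apply.
  exact: pattern_support gij.
have SBA : S n \subset S m.
  apply/subsetP => -[i' j']; rewrite !inE /= => /andP[ij' nij']; rewrite ij'.
  exact: (admissible_total (ijd _ _ ij) (ijd _ _ ij') mij nij nij').
have nsep (l : nat ^ k.+1) (i1 j1 i2 j2 : 'I_d.+1) :
    (i1, j1) \in S m :\: S n -> (i2, j2) \in S m :\: S n ->
    admissible d l i1 j1 -> admissible d l i2 j2.
  rewrite !inE /= => /andP[+ /andP[ij1 m1]] /andP[+ /andP[ij2 m2]] l1.
  rewrite ij1 ij2 /= => n1 n2.
  apply: contraT => l2; case: (nAB l).
  rewrite (generated_filterE pi_pattern) AE BE.
  by split; [apply: (chain _ _ i1 j1) | apply: (chain _ _ i2 j2)].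
have DE : S m :\: S n \subset [set (i, j); (rev_ord j, rev_ord i)].
  have Dij : (i, j) \in S m :\: S n by rewrite !inE /= ij /= nij mij.
  apply/subsetP => -[i' j'] D'; have := D'; rewrite !inE /= => /andP[_ /andP[ij' _]].
  have no1 := nsep _ _ _ _ _ Dij D'; have no2 := nsep _ _ _ _ _ D' Dij.
  have id := ijd _ _ ij; have id' := ijd _ _ ij'.
  have s1 := @admissible_separate d k _ _ _ _ id id'.
  have s2 := @admissible_separate d k _ _ _ _ id' id.
  have {}s1 : ~ (j - i < j' - i' \/ j - i = j' - i' /\
      minn k (minn i' (d - j')) < minn k (minn i (d - j)))%N.
    by move=> /s1[l l1 /negP]; apply; apply: no2.
  have {}s2 : ~ (j' - i' < j - i \/ j' - i' = j - i /\
      minn k (minn i (d - j)) < minn k (minn i' (d - j')))%N.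
    by move=> /s2[l l1 /negP]; apply; apply: no1.
  rewrite !xpair_eqE -!val_eqE /=; lia.
have D0 : (0 < #|S m :\: S n|)%N.
  by apply/card_gt0P; exists (i, j); rewrite !inE /= ij /= nij mij.
have D2 : (#|S m :\: S n| <= 2)%N.
  by apply: leq_trans (subset_leq_card DE) _; rewrite cards2; case: (_ != _).
have nU x := generated_filter_normal pi x.
have AU : A \subset U by rewrite -Am normal_sub ?nU.
have [sBU nBU] : B \subset U /\ U \subset 'N(B).
  by rewrite -Bn; have /andP[] := nU n.
rewrite card_quotient ?(subset_trans AU) // -divgS ?proper_sub //.
rewrite AE BE !card_pattern // -expnB ?prime_gt0 ?subset_leq_card //.
rewrite -/(S m) -/(S n) -cardsDS //.
by move: D0 D2; case: #|_| => [|[|[|]]] // _ _; [left | right].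
Qed.

End Factors.

(** * Coordinates on the homogeneous components *)

Section Coordinates.

Variables (p d k : nat) (gT : finGroupType) (U : {group gT}).
Variable (mx : matrix_group p d U) (pi : prefilter U k).
Hypothesis pi_pattern : forall n,
  in_S n -> pi n = pattern mx (admissible d n) :> {set gT}.

Local Notation alpha := (generated_filter pi).
Local Notation B := (boundary pi).

Definition diag_entry (r a : nat) (g : gT) : 'F_p := mx g (inord a) (inord (a + r)).

Lemma alphaU n g : g \in alpha n -> g \in U.
Proof. by apply: (subsetP (normal_sub (generated_filter_normal pi n))). Qed.

Section Level.

Variable n : nat ^ k.+1.
Hypothesis n0 : (0 < n ord0)%N.
Hypothesis nl : forall l, l != ord0 -> n l = 0%N.
Local Notation r := (n ord0).

Lemma admissible_level i j : admissible d n i j = (r <= j - i)%N.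
Proof.
apply/admissibleP/idP => [|]; first by lia.
rewrite leq_eqVlt => /orP[/eqP rij|]; last by left.
right; split=> // l l0 _ _; by rewrite nl // -val_eqE -lt0n.
Qed.

Lemma diag_entryM a g h : (a + r <= d)%N -> g \in alpha n -> h \in alpha n ->
  diag_entry r a (g * h) = (diag_entry r a g + diag_entry r a h)%R.
Proof.
move=> ad gn hn; have [ga ha] := (alphaU gn, alphaU hn).
have aE : (inord a : 'I_d.+1) = a :> nat by apply: inordK; lia.
have arE : (inord (a + r) : 'I_d.+1) = a + r :> nat by apply: inordK; lia.
rewrite /diag_entry (unitri_mul_entry mx) // ?aE ?arE; last by lia.
rewrite big1 ?addr0 // => l /andP[al lr].
move: gn; rewrite (generated_filterE pi_pattern) => gn.
rewrite (pattern_entry gn) ?mul0r ?aE // admissible_level; lia.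
Qed.

Lemma boundary_sub : B n \subset alpha n.
Proof.
rewrite (boundaryE pi_pattern) // (generated_filterE pi_pattern).
by apply: patternS => i j ij jd; rewrite admissible_level /boundary_root; lia.
Qed.

Lemma diag_entry_boundary a g : (k <= a)%N -> (a + r + k <= d)%N ->
  g \in B n -> diag_entry r a g = 0%R.
Proof.
move=> ka ad; rewrite (boundaryE pi_pattern) // => gB.
have aE : (inord a : 'I_d.+1) = a :> nat by apply: inordK; lia.
have arE : (inord (a + r) : 'I_d.+1) = a + r :> nat by apply: inordK; lia.
by apply: (pattern_entry gB); rewrite ?aE ?arE /boundary_root; lia.
Qed.

(** The entries that are required to vanish are those at the roots of height r
    outside of the first k layers. *)
Lemma mem_boundary g : g \in alpha n ->
    (forall a, (k <= a)%N -> (a + r + k <= d)%N -> diag_entry r a g = 0%R) ->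
  g \in B n.
Proof.
move=> gn g0; rewrite (boundaryE pi_pattern) //; apply: mem_pattern.
  exact: alphaU gn.
move: gn; rewrite (generated_filterE pi_pattern) => gn i j ij gij.
have := pattern_support gn ij gij; rewrite admissible_level => rij.
have jd : (j <= d)%N by rewrite -ltnS.
apply: contraT => nb; case/eqP: gij.
have ai : i = inord i :> 'I_d.+1 by rewrite inord_val.
have [jE ki] : i + r = j /\ (k <= i)%N && (i + r + k <= d)%N.
  by move: nb; rewrite /boundary_root; lia.
have aj : j = inord (i + r) :> 'I_d.+1 by rewrite jE inord_val.
by rewrite {1}ai aj; apply: g0; case/andP: ki.
Qed.

Definition level_coord (a : nat) (w : coset_of (B n)) : 'F_p :=
  diag_entry r a (repr w).

Lemma level_coord_coset a g : (k <= a)%N -> (a + r + k <= d)%N ->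
  g \in alpha n -> level_coord a (coset (B n) g) = diag_entry r a g.
Proof.
move=> ka ad gn; have nB : g \in 'N(B n).
  by apply: (subsetP (normal_norm (boundary_normal pi n))); apply: alphaU gn.
have : repr (coset (B n) g) \in B n :* g.
  by rewrite -(val_coset nB); apply: mem_repr_coset.
rewrite /level_coord => /rcosetP[b bB ->].
rewrite diag_entryM ?(subsetP boundary_sub b bB) //; last by lia.
by rewrite diag_entry_boundary ?add0r.
Qed.

Lemma level_coord_inj g h : g \in alpha n -> h \in alpha n ->
    (forall a, (k <= a)%N -> (a + r + k <= d)%N ->
       diag_entry r a g = diag_entry r a h) ->
  coset (B n) g = coset (B n) h.
Proof.
move=> gn hn gh; have nB x : x \in alpha n -> x \in 'N(B n).
  by move=> /alphaU; apply/subsetP/normal_norm/boundary_normal.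
have gh1 : g * h^-1 \in alpha n by rewrite groupM ?groupV.
have : g * h^-1 \in B n.
  apply: mem_boundary => // a ka ad; have := gh a ka ad.
  have ad' : (a + r <= d)%N by lia.
  rewrite -{1}(mulgKV h g) (diag_entryM ad' gh1 hn).
  by rewrite -{2}[diag_entry r a h]add0r => /addIr.
move/coset_id; rewrite morphM ?morphV ?nB ?groupV // => /eqP.
by rewrite -eq_mulgV1 => /eqP.
Qed.

End Level.

Lemma commutator_entry g h a : (a.+2 <= d)%N -> g \in U -> h \in U ->
  diag_entry 2 a [~ g, h] =
  (diag_entry 1 a g * diag_entry 1 a.+1 h -
   diag_entry 1 a.+1 g * diag_entry 1 a h)%R.
Proof.
move=> ad gU hU; rewrite /diag_entry !addn1 !addn2.
have aE x : (x <= d)%N -> (inord x : 'I_d.+1) = x :> nat by apply: inordK.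
pose i : 'I_d.+1 := inord a; pose l : 'I_d.+1 := inord a.+1.
pose j : 'I_d.+1 := inord a.+2.
have [iE lE jE] : [/\ i = a :> nat, l = a.+1 :> nat & j = a.+2 :> nat].
  by split; apply: aE; lia.
rewrite -/i -/l -/j.
have E : (h * g) * [~ g, h] = g * h.
  by rewrite commgEl conjgE !mulgA mulgK mulgV mul1g.
have cU : [~ g, h] \in U by rewrite groupR.
have two u v : u \in U -> v \in U ->
    mx (u * v) i j = (mx u i j + mx v i j + mx u i l * mx v l j)%R.
  move=> uU vU; rewrite (unitri_mul_entry mx) // ?iE ?jE //.
  rewrite (big_pred1 l) // => x; rewrite /= -val_eqE /= lE; lia.
have one u v : u \in U -> v \in U -> mx (u * v) l j = (mx u l j + mx v l j)%R.
  move=> uU vU; rewrite (unitri_mul_entry mx) // ?lE ?jE // big1 ?addr0 // => x.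
  by lia.
have c1 : mx [~ g, h] l j = 0%R.
  have := one _ _ (groupM hU gU) cU; rewrite E one // one // => /eqP.
  by rewrite [(mx h l j + _)%R]addrC -subr_eq0 opprD addNKr oppr_eq0 => /eqP.
have := two _ _ (groupM hU gU) cU; rewrite E two // two // c1 mulr0 addr0.
move=> e; apply: (addrI (mx h i j + mx g i j + mx h i l * mx g l j)%R).
rewrite -e; ring.
Qed.

End Coordinates.

Section FactorClasses.

Variables (gT : finGroupType) (U : {group gT}) (k : nat) (pi : prefilter U k).
Variables (n : nat ^ k.+1) (n0 : (n != 0)%R).
Local Notation alpha := (generated_filter pi).
Local Notation B := (boundary pi).

Definition factor_class (g : gT) : factor_add pi n0 :=
  to_add_group (factor_abelian pi n0) (coset (B n) g).

Lemma factor_normal g : g \in alpha n -> g \in 'N(B n).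
Proof.
move=> gn; apply: (subsetP (normal_norm (boundary_normal pi n))).
exact: (subsetP (normal_sub (generated_filter_normal pi n))).
Qed.

Lemma of_factor_class g : g \in alpha n ->
  of_add_group (factor_class g) = coset (B n) g.
Proof.
move=> gn; apply: to_add_groupK; apply: mem_morphim => //.
exact: factor_normal.
Qed.

Lemma factor_classP (u : factor_add pi n0) :
  exists2 g, g \in alpha n & u = factor_class g.
Proof.
have /morphimP[g gN gn ug] := of_add_groupP u; exists g => //.
by apply: of_add_group_inj; rewrite of_factor_class.
Qed.

Lemma factor_classM g h : g \in alpha n -> h \in alpha n ->
  factor_class (g * h) = (factor_class g + factor_class h)%R.
Proof.
move=> gn hn; apply: of_add_group_inj.
rewrite of_add_groupD !of_factor_class ?groupM //.
by rewrite morphM ?factor_normal.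
Qed.

End FactorClasses.

Section FactorForm.

Variables (p d k : nat) (gT : finGroupType) (U : {group gT}).
Variable (mx : matrix_group p d U) (pi : prefilter U k).
Hypothesis pi_pattern : forall n,
  in_S n -> pi n = pattern mx (admissible d n) :> {set gT}.

Local Notation alpha := (generated_filter pi).
Local Notation B := (boundary pi).
Local Notation m := (d - k.*2)%N.
Local Notation e := (e1 : nat ^ k.+1).

Lemma e1_head : (e1 : nat ^ k.+1) ord0 = 1%N. Proof. by rewrite ffunE. Qed.
Lemma e1_tail (l : 'I_k.+1) : l != ord0 -> e l = 0%N.
Proof. by rewrite ffunE => /negPf ->. Qed.
Lemma e11_head : (e + e)%R ord0 = 2%N. Proof. by rewrite !ffunE. Qed.
Lemma e11_tail (l : 'I_k.+1) : l != ord0 -> (e + e)%R l = 0%N.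
Proof. by rewrite !ffunE => /negPf ->. Qed.

Lemma e1_gt0 : (0 < e ord0)%N. Proof. by rewrite e1_head. Qed.
Lemma e11_gt0 : (0 < (e + e)%R ord0)%N. Proof. by rewrite e11_head. Qed.

Lemma alpha_e1 : alpha e = U :> {set gT}.
Proof.
rewrite (generated_filterE pi_pattern) -(patternT mx).
apply/eqP; rewrite eqEsubset !patternS // => i j ij jd _.
by rewrite (admissible_level d e1_gt0 e1_tail) e1_head; lia.
Qed.

Lemma boundary_e1 : B e = pattern mx (boundary_root d k 1) :> {set gT}.
Proof. by rewrite (boundaryE pi_pattern e1_gt0 e1_tail) e1_head. Qed.

(** The value 0 off the range of the vertices makes the coordinate additive for
    every i. *)
Definition e1_coord (i : nat) (u : factor_add pi (e1_neq0 k)) : 'F_p :=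
  if (i < m)%N then level_coord mx (k + i) (of_add_group u) else 0%R.

Definition e1_vec (i : nat) : factor_add pi (e1_neq0 k) :=
  factor_class pi (e1_neq0 k) (elementary mx (inord (k + i)) (inord (k + i).+1) 1%R).

Local Notation e11_neq0 := (index_addr_neq0 e1 (e1_neq0 k)).

Definition e11_coord (i : nat) (u : factor_add pi e11_neq0) : 'F_p :=
  level_coord mx (k + i) (of_add_group u).

Lemma e1_coordE i g : (i < m)%N -> g \in U ->
  e1_coord i (factor_class pi (e1_neq0 k) g) = diag_entry mx 1 (k + i) g.
Proof.
move=> im gU; rewrite /e1_coord im of_factor_class ?alpha_e1 //.
rewrite (level_coord_coset pi_pattern e1_gt0 e1_tail) ?e1_head ?alpha_e1 //; lia.
Qed.

Lemma e11_coordE i g : (i.+1 < m)%N -> g \in alpha (e + e)%R ->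
  e11_coord i (factor_class pi e11_neq0 g) = diag_entry mx 2 (k + i) g.
Proof.
move=> im gU; rewrite /e11_coord of_factor_class //.
rewrite (level_coord_coset pi_pattern e11_gt0 e11_tail) ?e11_head //; lia.
Qed.

Lemma e1_classP (u : factor_add pi (e1_neq0 k)) :
  exists2 g, g \in U & u = factor_class pi (e1_neq0 k) g.
Proof. by have [g] := factor_classP u; rewrite alpha_e1; exists g. Qed.

Lemma e1_coordD i : {morph e1_coord i : u v / (u + v)%R}.
Proof.
move=> u v; have [g gU ->] := e1_classP u; have [h hU ->] := e1_classP v.
have [im|im] := ltnP i m; last by rewrite /e1_coord ltnNge im addr0.
rewrite -factor_classM ?alpha_e1 // !e1_coordE ?groupM //.
have := @diag_entryM p d k gT U mx pi pi_pattern e e1_gt0 e1_tail (k + i) g h.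
by rewrite e1_head alpha_e1; apply=> //; lia.
Qed.

Lemma e1_coord_vec i j : (i < m)%N -> (j < m)%N ->
  e1_coord i (e1_vec j) = (i == j)%:R%R.
Proof.
move=> im jm; have aE a : (a <= d)%N -> (inord a : 'I_d.+1) = a :> nat by apply: inordK.
have jj : ((inord (k + j) : 'I_d.+1) < (inord (k + j).+1 : 'I_d.+1))%N.
  by rewrite !aE; lia.
rewrite e1_coordE // ?elementary_in // /diag_entry elementaryE // -!val_eqE /=.
rewrite !aE; try lia; rewrite addn1 (ltn_eqF (ltnSn _)) add0r mul1r eqSS.
by rewrite andbb eqn_add2l.
Qed.

Lemma e1_coord_inj u v :
  (forall i, (i < m)%N -> e1_coord i u = e1_coord i v) -> u = v.
Proof.
have [g gU ->] := e1_classP u; have [h hU ->] := e1_classP v => uv.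
apply: of_add_group_inj; rewrite !of_factor_class ?alpha_e1 //.
apply: (level_coord_inj pi_pattern e1_gt0 e1_tail); rewrite ?alpha_e1 //.
rewrite e1_head => a ka ad; have am : (a - k < m)%N by lia.
by have := uv _ am; rewrite !e1_coordE // subnKC.
Qed.

Lemma e11_coord_inj w w' :
  (forall i, (i.+1 < m)%N -> e11_coord i w = e11_coord i w') -> w = w'.
Proof.
have [g gU ->] := factor_classP w; have [h hU ->] := factor_classP w' => uv.
apply: of_add_group_inj; rewrite !of_factor_class //.
apply: (level_coord_inj pi_pattern e11_gt0 e11_tail) => //.
rewrite e11_head => a ka ad; have am : ((a - k).+1 < m)%N by lia.
by have := uv _ am; rewrite !e11_coordE // subnKC.
Qed.

Lemma e11_coord_circ i u v : (i.+1 < m)%N ->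
  e11_coord i (circ pi (e1_neq0 k) (e1_neq0 k) u v) =
  (e1_coord i u * e1_coord i.+1 v - e1_coord i.+1 u * e1_coord i v)%R.
Proof.
move=> im; have [g gU ->] := e1_classP u; have [h hU ->] := e1_classP v.
have gh : [~ g, h] \in alpha (e + e)%R.
  by apply: (subsetP (generated_filter_comm pi e e)); rewrite mem_commg ?alpha_e1.
have -> : circ pi (e1_neq0 k) (e1_neq0 k) (factor_class pi (e1_neq0 k) g)
    (factor_class pi (e1_neq0 k) h) = factor_class pi e11_neq0 [~ g, h].
  apply: of_add_group_inj; rewrite of_factor_class //.
  by apply: commutationE; rewrite ?of_factor_class ?alpha_e1.
have im' := ltnW im.
rewrite e11_coordE // !e1_coordE // (commutator_entry mx) ?addnS //; lia.
Qed.

Definition stage_form : path_form p m (circ pi (e1_neq0 k) (e1_neq0 k)) :=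
  PathForm e1_coordD e1_coord_vec e1_coord_inj e11_coord_inj e11_coord_circ.

Lemma radical_trivial_small : (0 < m <= 2)%N -> radical_trivial pi.
Proof.
move=> m2 a aJ; have [m1|m1] : m = 1%N \/ m = 2%N by lia.
  exact: (path_radical_dim1 stage_form m1 aJ).
exact: (path_radical_dim2 stage_form m1 aJ).
Qed.

Lemma radical_nontrivial : (2 < m)%N -> ~ radical_trivial pi.
Proof.
move=> m2 triv; have [a aJ] := path_radical_neq0 stage_form m2.
by rewrite (triv a aJ) eqxx.
Qed.

End FactorForm.

(** * One step of the refinement *)

Section Refine.

Variables (p d k : nat) (gT : finGroupType) (U : {group gT}).
Variable (mx : matrix_group p d U) (pi : prefilter U k).
Hypothesis pi_pattern : forall n,
  in_S n -> pi n = pattern mx (admissible d n) :> {set gT}.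
Hypothesis dk : (2 < d - k.*2)%N.

Local Notation alpha := (generated_filter pi).
Local Notation B := (boundary pi).
Local Notation m := (d - k.*2)%N.
Local Notation e := (e1 : nat ^ k.+1).
Local Notation cls := (factor_class pi (e1_neq0 k)).
Let alphaE := alpha_e1 pi_pattern.
Let form := stage_form pi_pattern.

Lemma mem_radical_image i u a :
  ideal_exp (@jacobson_radical (adj pi)) i a ->
  of_add_group (adjoint_act u a) \in radical_image pi i.
Proof. by move=> ai; apply: mem_gen; rewrite inE; apply/asboolP; exists u, a. Qed.

Lemma radical_subgroup0 : radical_subgroup pi 0 = U :> {set gT}.
Proof.
apply/eqP; rewrite eqEsubset (normal_sub (radical_subgroup_normal _ _)).
apply/subsetP => g gU; have ga : g \in alpha e by rewrite alphaE.
apply/morphpreP; split; first exact: factor_normal.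
suff : of_add_group (cls g) \in radical_image pi 0 by rewrite of_factor_class.
rewrite -(adjoint_act1 (circ pi (e1_neq0 k) (e1_neq0 k)) (cls g)).
exact: mem_radical_image.
Qed.

(** The radical moves everything to the two ends of the path, that is to the
    simple roots of the layer k. *)
Lemma radical_subgroup1 :
  radical_subgroup pi 1 = pattern mx (boundary_root d k.+1 1) :> {set gT}.
Proof.
have sub_U := subsetP (pattern_sub mx (boundary_root d k.+1 1)).
have BE := boundary_e1 pi_pattern.
pose P := pattern_group mx (boundary_root_ideal d k.+1 1).
have BP : B e <| P.
  apply: normalS (boundary_normal pi e); last exact: pattern_sub.
  by rewrite BE; apply: patternS => i j _ _; rewrite /boundary_root; lia.
apply/eqP; rewrite eqEsubset; apply/andP; split.
  rewrite -[pattern _ _]/(gval P) -(quotientGK BP); apply: morphpreS.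
  rewrite gen_subG; apply/subsetP => w; rewrite inE => /asboolP[u [a [aJ ->]]].
  have [g gU ga] := e1_classP pi_pattern (adjoint_act u a).
  rewrite ga of_factor_class ?alphaE // mem_quotient //.
  apply: (mem_pattern gU) => i j ij gij; have jd : (j <= d)%N by rewrite -ltnS.
  apply: contraT => nb; case/eqP: gij.
  have [jE [ki id]] : j = i.+1 :> nat /\ (k < i)%N /\ (j + k < d)%N.
    by move: nb; rewrite /boundary_root; lia.
  have im : (i - k < m)%N by lia.
  have ik : (0 < i - k)%N by lia.
  have ik1 : ((i - k).+1 < m)%N by lia.
  have aJ1 := (ideal_exp1_radical form a dk).1 aJ.
  have := radical_image_inner form u dk aJ1 ik ik1.
  rewrite /= ga (e1_coordE pi_pattern) // /diag_entry subnKC ?(ltnW ki) //.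
  by rewrite addn1 -jE !inord_val.
apply/subsetP => g gP; have gU := sub_U g gP.
have ga : g \in alpha e by rewrite alphaE.
apply/morphpreP; split; first exact: factor_normal.
suff : of_add_group (cls g) \in radical_image pi 1 by rewrite of_factor_class.
have [i i0 im|u1 [u2 [a1 [a2 [a1J a2J ->]]]]] :=
  @radical_image_outer _ _ _ _ _ form (cls g) dk.
  rewrite /= (e1_coordE pi_pattern) //; last by lia.
  apply: (pattern_entry gP); rewrite ?inordK ?addn1 /boundary_root; lia.
rewrite of_add_groupD groupM // mem_radical_image //.
  exact/(ideal_exp1_radical form).
exact/(ideal_exp1_radical form).
Qed.

Lemma radical_subgroup2 i :
  radical_subgroup pi i.+2 = pattern mx (boundary_root d k 1) :> {set gT}.
Proof.
have BE := boundary_e1 pi_pattern.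
have im1 : radical_image pi i.+2 \subset [1].
  rewrite gen_subG; apply/subsetP => w; rewrite inE => /asboolP[u [a [aJ ->]]].
  by rewrite (ideal_exp2_radical form dk aJ) adjoint_act0 of_add_group0 inE.
rewrite -BE; apply/setP => g; apply/idP/idP.
  move=> /morphpreP[gN gi]; apply: coset_idr => //.
  by have := subsetP im1 _ gi; rewrite inE => /eqP.
move=> gB; apply/morphpreP; split.
  exact: (subsetP (normG _) g gB).
suff : coset (B e) g \in radical_image pi i.+2 by [].
by rewrite (coset_id gB) group1.
Qed.

Lemma index_frontE (n : nat ^ k.+2) (l : 'I_k.+1) (l' : 'I_k.+2) :
  l = l' :> nat -> index_front n l = n l'.
Proof. by move=> ll'; rewrite ffunE; congr (n _); apply: val_inj. Qed.

(** For an index (e1, v) the simple roots are restricted by v only: all of them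
    are admissible for v = 0, those of the first k + 1 layers for v = 1, and
    those of the first k layers for v > 1. Any other index with n_0 = 1 has a
    nonzero component which excludes all simple roots that the last component
    could restrict. *)
Lemma refine_pattern (n : nat ^ k.+2) : in_S n ->
  refine pi n = pattern mx (admissible d n) :> {set gT}.
Proof.
rewrite in_SE => n0; have f0 : index_front n ord0 = n ord0 by apply: index_frontE.
rewrite /refine; case: eqP => [fe | /eqP fe].
  have {}n0 : n ord0 = 1%N by rewrite -f0 fe e1_head.
  have nl (l : 'I_k.+2) : (0 < l)%N -> l != ord_max -> n l = 0%N.
    move=> l0 lm; have lk : (l < k.+1)%N.
      by have := ltn_ord l; have : l != k.+1 :> nat by []; lia.
    rewrite -(@index_frontE n (Ordinal lk)) // fe e1_tail //.
    by rewrite -val_eqE -lt0n.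
  set v := Defs.index_last n.
  have nE i j : (i < j)%N -> (j <= d)%N -> admissible d n i j =
      (1 < j - i)%N || ((k <= minn i (d - j)) ==> (v <= (i < k.+1) + (d - j < k.+1)))%N.
    move=> ij jd; apply/admissibleP/orP; rewrite n0 => -[h|]; try by left.
      move=> [_ al]; right; apply/implyP => kt; apply: (al ord_max) => //=; lia.
    have [h|h] := ltnP 1 (j - i); first by left.
    move=> vP; right; split=> [|l l0 li lj]; first by lia.
    have [lE|lm] := eqVneq l ord_max; last by rewrite nl.
    by rewrite lE /=; apply: (implyP vP); move: li lj; rewrite lE /=; lia.
  case: v nE => [|[|v]] nE.
  - rewrite radical_subgroup0 -(patternT mx); apply: pattern_eq => i j ij jd.
    by rewrite nE // implybT orbT.
  - rewrite radical_subgroup1; apply: pattern_eq => i j ij jd.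
    by rewrite nE // /boundary_root; lia.
  - rewrite radical_subgroup2; apply: pattern_eq => i j ij jd.
    by rewrite nE // /boundary_root; lia.
have Sf : in_S (index_front n) by rewrite in_SE f0.
rewrite pi_pattern //; apply: pattern_eq => i j ij jd.
apply/admissibleP/admissibleP; rewrite f0 => -[h|[h al]]; try by left.
  right; split=> // l l0 li lj; have [lE|lm] := eqVneq l ord_max; last first.
    have lk : (l < k.+1)%N.
      by have := ltn_ord l; have : l != k.+1 :> nat by []; lia.
    by rewrite -(@index_frontE n (Ordinal lk)) //; apply: al.
  have h1 : n ord0 = 1%N by lia.
  case/eqP: fe; apply/ffunP => x; have [->|x0] := eqVneq x ord0.
    by rewrite f0 h1 e1_head.
  rewrite e1_tail //; move: li lj; rewrite lE /= => li lj.
  have xk := ltn_ord x; have x0' : (0 < x)%N by rewrite lt0n.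
  have [t1 t2] : (x <= i.+1 /\ x <= (d - j).+1)%N by lia.
  have [ix jx] : (i < x)%N = false /\ (d - j < x)%N = false by lia.
  by have := al x x0' t1 t2; rewrite ix jx leqn0 => /eqP.
right; split=> // l l0 li lj.
by rewrite (@index_frontE n l (widen_ord (leqnSn _) l)) //; apply: al.
Qed.

End Refine.

(** * The adjoint series *)

Lemma stage_pattern p d (gT : finGroupType) (U : {group gT})
    (mx : matrix_group p d U) k : (k.*2 < d)%N ->
  forall n, in_S n -> stage U k n = pattern mx (admissible d n) :> {set gT}.
Proof.
elim: k => [|k IHk] dk n.
  rewrite in_SE => n0; rewrite -(patternT mx); apply: pattern_eq => i j ij jd.
  apply/esym/admissibleP; have [h|h] := ltnP (n ord0) (j - i); first by left.
  by right; split=> [|l]; [lia | have := ltn_ord l; lia].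
apply: refine_pattern; last by lia.
by apply: IHk; lia.
Qed.

Lemma adjoint_series_factors p d (gT : finGroupType) (U : {group gT})
    (mx : matrix_group p d U) : prime p -> (0 < d)%N ->
  exists k, adjoint_process_stops_at U k /\
    forall A B : {group gT}, consecutive (stage_filter U k) A B ->
      #|A / B| = p \/ #|A / B| = (p ^ 2)%N.
Proof.
move=> p_pr d0; exists d.-1./2.
have dE := odd_double_half d.-1.
have dk : (d.-1./2.*2 < d)%N by lia.
split; last first.
  move=> A B; apply: (consecutive_factor p_pr (stage_pattern mx dk)); lia.
split; first by apply: (radical_trivial_small (stage_pattern mx dk)); lia.
move=> j jk; have jd : (j.*2 < d)%N by lia.
by apply: (radical_nontrivial (stage_pattern mx jd)); lia.
Qed.

Section GL.

Variables p d : nat.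

Local Open Scope ring_scope.

Lemma unitriangular_unitmx (M : 'M['F_p]_d.+1) : unitriangular M -> M \in unitmx.
Proof.
move=> /unitriangularP MU; rewrite -unitmx_tr unitmxE det_trig; last first.
  apply/is_trig_mxP => i j ij; rewrite mxE MU ?(ltnW ij) //.
  by have /negPf-> : j != i by rewrite neq_ltn ij orbT.
by rewrite big1 ?unitr1 // => i _; rewrite mxE MU // eqxx.
Qed.

Definition GL_matrix_group : matrix_group p d (unitriangular_group p d).
Proof.
apply: (@MatrixGroup p d _ (unitriangular_group p d) (fun g => @GLval d.+1 _ g)).
- exact: val_inj.
- by rewrite GL_1E.
- by move=> u v; rewrite GL_MxE.
- by move=> g; rewrite inE.
move=> M /unitriangular_unitmx MU.
by exists (Sub M MU : {'GL_d.+1['F_p]}); apply: (@SubK _ _ {'GL_d.+1['F_p]}).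
Defined.

End GL.

Theorem theorem1p1 (p d : nat) (p_prime : prime p) (p_ge3 : (3 <= p)%N)
    (d_ge1 : (1 <= d)%N) :
  exists k : nat,
    adjoint_process_stops_at (unitriangular_group p d) k /\
    forall A B : {group {'GL_d.+1[ 'F_p ]}},
      consecutive (stage_filter (unitriangular_group p d) k) A B ->
      (#|A / B| = p \/ #|A / B| = (p ^ 2)%N).
Proof. exact: adjoint_series_factors (GL_matrix_group p d) p_prime d_ge1. Qed.
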